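(* Let $d\ge 1$ be an integer and let $p:\mathbb{N}\to[0,1]$ satisfy one of the following, for some integer $v^*\ge 1$: (1) $p(n)\sim C\cdot\frac{\log n}{n^d}$ for a constant $C$ with $\frac{d!}{v^*+1}<C<\frac{d!}{v^*}$; (2) $p(n)\sim\frac{d!}{v^*}\cdot\frac{\log n}{n^d}$ and, with $$\omega(n)=\frac{v^*n^d\frac{p(n)}{d!}-\log n}{\log\log n},$$ either $\omega(n)\to+\infty$, or $\omega(n)\to-\infty$, or $\omega(n)\to C$ for some real $C$ with $l-1<C<l$ for some $l\in\mathbb{N}$. Then $p$ is a zero-one law; that is, for every first-order property $P$ of $(d+1)$-uniform hypergraphs, the limit $\lim_{n\to\infty}\mathbb{P}[G^{d+1}(n,p(n))\models P]$ exists and is either $0$ or $1$.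
   Context: $G^{d+1}(n,p)$ is the random $(d+1)$-uniform hypergraph on $n$ labelled vertices in which each of the $\binom{n}{d+1}$ potential edges ($(d+1)$-element vertex sets) is present with probability $p$, independently of the others. First-order (elementary) properties are those expressible by a sentence of first-order logic with equality in the language with one $(d+1)$-ary relation symbol $\sigma$, where quantifiers range over vertices and $\sigma(x_0,\dots,x_d)$ means that $\{x_0,\dots,x_d\}$ is an edge. $f\sim g$ means $f(n)/g(n)\to 1$. $\mathbb{N}=\{0,1,2,\dots\}$ for the range of $l$. *)

(* Defs.v *)
From mathcomp Require Import all_boot all_order all_algebra.
From mathcomp Require Import all_classical all_reals all_analysis.

Set Implicit Arguments.
Unset Strict Implicit.
Unset Printing Implicit Defensive.

Import Order.TTheory GRing.Theory Num.Theory.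
Import numFieldNormedType.Exports.

Local Open Scope classical_set_scope.
Local Open Scope ring_scope.

(** First-order formulas with equality over one [k]-ary relation symbol, with
    free variables among [m] ones; the binder of [fo_ex] is variable [ord0] of
    its body. The connectives and quantifiers left out are definable. *)
Inductive fo_formula (k : nat) : nat -> Type :=
| fo_eq m (i j : 'I_m) : fo_formula k m
| fo_rel m (x : k.-tuple 'I_m) : fo_formula k m
| fo_not m (phi : fo_formula k m) : fo_formula k m
| fo_and m (phi psi : fo_formula k m) : fo_formula k m
| fo_ex m (phi : fo_formula k m.+1) : fo_formula k m.

Definition fo_sentence (k : nat) : Type := fo_formula k 0.

Definition env_cons (V : Type) m (v : V) (e : 'I_m -> V) : 'I_m.+1 -> V :=
  fun i => if unlift ord0 i is Some j then e j else v.

(** A hypergraph on [V] is given by its edge set [H]. When [H] is [k]-uniform, a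
    tuple with a repeated entry spans fewer than [k] vertices, so the relation
    fails on it. *)
Fixpoint fo_sat (V : finType) (H : {set {set V}}) k m (phi : fo_formula k m) :
    ('I_m -> V) -> bool :=
  match phi in fo_formula _ m' return ('I_m' -> V) -> bool with
  | fo_eq _ i j => fun e => e i == e j
  | fo_rel _ x => fun e => [set v in map e x] \in H
  | fo_not _ phi1 => fun e => ~~ fo_sat H phi1 e
  | fo_and _ phi1 phi2 => fun e => fo_sat H phi1 e && fo_sat H phi2 e
  | fo_ex _ phi1 => fun e => [exists v, fo_sat H phi1 (env_cons v e)]
  end.

Definition models (V : finType) k (H : {set {set V}}) (phi : fo_sentence k) :
    bool :=
  fo_sat H phi (fun i : 'I_0 => match notF (ltn_ord i) with end).

Definition potential_edges (k n : nat) : {set {set 'I_n}} :=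
  [set e : {set 'I_n} | #|e| == k].

Section RandomHypergraph.
Variable R : realType.

(** The law of the random [k]-uniform hypergraph on ['I_n]: the product over all
    potential edges of Bernoulli laws of parameter [q]. *)
Definition hypergraph_weight (k n : nat) (q : R) (H : {set {set 'I_n}}) : R :=
  \prod_(e in potential_edges k n) (if e \in H then q else 1 - q).

Definition hypergraph_prob (k n : nat) (q : R) (A : pred {set {set 'I_n}}) : R :=
  \sum_(H in powerset (potential_edges k n) | A H) hypergraph_weight k q H.

(** The joint law of the presence of the potential edges in [T]; the case
    [S = T = set0] says that the total mass is [1]. *)
Lemma hypergraph_prob_indep k n q (S T : {set {set 'I_n}}) :
    S \subset T -> T \subset potential_edges k n ->
  hypergraph_prob k q (fun H => H :&: T == S)
    = q ^+ #|S| * (1 - q) ^+ #|T :\: S|.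
Proof.
move=> sST sTE; rewrite /hypergraph_prob; set E := potential_edges k n.
pose F (e : {set 'I_n}) : R :=
  if e \in E then (if (e \in T) && (e \notin S) then 0 else q) else 0.
pose G (e : {set 'I_n}) : R :=
  if e \in E then (if e \in S then 0 else 1 - q) else 1.
have FG e : F e + G e =
    (if e \in S then q else 1) * (if e \in T :\: S then 1 - q else 1).
  rewrite /F /G finset.in_setD; have [eE|eE] := boolP (e \in E).
    have [eS|eS] := boolP (e \in S).
      by rewrite (fintype.subsetP sST _ eS) /= addr0 mulr1.
    by case: (e \in T); rewrite /= mul1r ?add0r // addrC subrK.
  have /negbTE eT : e \notin T by apply: contra eE; exact: (fintype.subsetP sTE).
  have /negbTE eS : e \notin S by apply/negP => /(fintype.subsetP sST); rewrite eT.
  by rewrite eT eS andbF add0r mulr1.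
transitivity (\prod_e (F e + G e)).
  rewrite bigA_distr [RHS](bigID (fun H => (H \in powerset E) && (H :&: T == S))).
  rewrite /= [X in _ + X]big1 ?addr0 => [|H].
    apply: eq_bigr => H /andP[]; rewrite powersetE => /fintype.subsetP sHE /eqP HTS.
    rewrite /hypergraph_weight big_mkcond; apply: eq_bigr => e _.
    have inS : (e \in S) = (e \in H) && (e \in T) by rewrite -HTS inE.
    rewrite /F /G inS -/E; have [eH|_] := boolP (e \in H).
      by rewrite (sHE _ eH) /=; case: (e \in T).
    by case: (e \in E).
  rewrite negb_and powersetE => /orP[/fintype.subsetPn[e eH eE]|/eqP HTS].
    by rewrite (bigD1 e) //= eH /F (negbTE eE) mul0r.
  have [e He|HS] := pickP (fun e => (e \in H :&: T) != (e \in S)); last first.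
    by case: HTS; apply/setP => e; apply/eqP; have /negbFE := HS e.
  rewrite (bigD1 e) //= [X in X * _](_ : _ = 0) ?mul0r //.
  move: He; rewrite inE /F /G; have [eS|eS] := boolP (e \in S).
    have eT := fintype.subsetP sST _ eS.
    by rewrite eT andbT; case: (e \in H) => // _; rewrite (fintype.subsetP sTE _ eT).
  case: (e \in H) => //=; have [eT|//] := boolP (e \in T) => _ /=.
  by rewrite (fintype.subsetP sTE _ eT).
under eq_bigr do rewrite FG.
by rewrite big_split /= -!big_mkcond !prodr_const.
Qed.

(** [f n / g n --> 1]. *)
Definition asymp_equiv (f g : nat -> R) : Prop :=
  (fun n => f n / g n) @ \oo --> (1 : R).

Definition zero_one_law (d : nat) (p : nat -> R) : Prop :=
  forall phi : fo_sentence d.+1,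
    let prob n :=
      hypergraph_prob d.+1 (p n) (fun H : {set {set 'I_n}} => models H phi) in
    (prob @ \oo --> (0 : R)) \/ (prob @ \oo --> (1 : R)).

End RandomHypergraph.

(* Main.v *)
Require Import Defs.
From mathcomp Require Import all_boot all_order all_algebra.
From mathcomp Require Import all_classical all_reals all_analysis.
From mathcomp Require Import zify ring lra.

Set Implicit Arguments.
Unset Strict Implicit.
Unset Printing Implicit Defensive.

Import Order.TTheory GRing.Theory Num.Theory.
Import numFieldNormedType.Exports.

(** A configuration of a hypergraph [H] consists of a set [U] of [v] vertices, a
    set [F] of [e] edges of [H] inside [U], and a set [W] of [m] vertices of [U]
    all of whose edges in [H] belong to [F]. Let [mu = p n^d / d!] be the
    asymptotic mean degree, and [Q = exp (- mu)], asymptotically the probability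
    that a vertex is isolated.
    The expected number of configurations of a given shape is about
    [n^v p^e Q^m] ([mean_value]). Since [n^d p] is of order [log n], each unit of
    [v - d e] is worth a factor [n], each edge a power of [log n], and each
    vertex of [W] a factor [n^(-c)], where [c] is the limit of [mu / log n].
    Connected shapes have [v <= d e + 1]. The hypotheses on [p] say that the mean
    of each of them tends to [0] or to infinity ([regime_dichotomy]): this is
    visible on the exponent [v - d e - m c], and on the number of edges when
    [v = d e] and [m = 0], unless [v = d e + 1] and [m c = 1]. In that last case [m] is the integer [v^*] of the statement, the mean is
    [(log n)^(e - omega)] up to lower order terms, and [omega] stays away from
    the natural numbers ([window_critical]).

    By the first moment method, with high probability no shape of vanishing mean
    occurs ([whp_sparse]). By the second moment method a pattern occurs with high
    probability as soon as the means of its sub-patterns tend to infinity. It then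
    even occurs generically, which means that around it the hypergraph grows like
    a tree whose new vertices have large degree: an edge closing a cycle or a new
    vertex of small degree would multiply the mean by a quantity that tends to
    [0] ([whp_occurs_generically]).

    Two hypergraphs with these two properties satisfy the same first-order
    sentences of a given complexity ([sat_invariant]). The proof is an
    Ehrenfeucht-Fraisse game in which a position is one pattern occurring
    generically in both hypergraphs. A vertex at small distance from the pattern
    is reached by pendant edges, which can be added on both sides because
    incomplete vertices have large degree ([reach_extension]). A vertex far from
    the pattern is first enclosed in a generic configuration of bounded size: each
    failure of genericity creates a cycle or a vertex of small degree, and
    absence of dense configurations bounds the number of failures
    ([hull_exists]). The means of the sub-configurations of this hull do not
    vanish, since they occur; so they tend to infinity, and the other hypergraph
    contains many copies of the hull that are far apart, one of which is far from
    the position ([admissible_copies], [far_copy]).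

    Consequently a sentence holds either in all these typical hypergraphs or in
    none of them, and its probability tends to [1] or to [0]
    ([zero_one_of_dichotomy]). *)

(** * Distance and tree-like neighbourhoods *)

Section Configurations.
Local Open Scope set_scope.
Local Open Scope nat_scope.

Variables (T : finType) (H : {set {set T}}).

Implicit Types (U W e : {set T}) (F : {set {set T}}) (x y z : T).

Definition star x : {set {set T}} := [set e in H | x \in e].

Fixpoint reach r x y : Prop :=
  if r is r'.+1 then
    exists z, (x = z \/ exists e, [/\ e \in H, x \in e & z \in e]) /\ reach r' z y
  else x = y.

Definition far r U1 U2 := forall x y, x \in U1 -> y \in U2 -> ~ reach r x y.

Lemma reach_mono r r' x y : r <= r' -> reach r x y -> reach r' x y.
Proof.
elim: r' r x => [|r' IH] [|r] x //=.
  by move=> _ ->; exists y; split; [left|exact: (IH 0)].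
by rewrite ltnS => rr' [z [xz zy]]; exists z; split=> //; exact: IH zy.
Qed.

Lemma reach_refl r x : reach r x x.
Proof. exact: (@reach_mono 0). Qed.

Lemma reach_trans r r' x y z : reach r x y -> reach r' y z -> reach (r + r') x z.
Proof.
elim: r x => [|r IH] x /=; first by move=> ->.
by move=> [u [xu uy]] yz; exists u; split=> //; exact: IH.
Qed.

Lemma reach_edge e x y : e \in H -> x \in e -> y \in e -> reach 1 x y.
Proof. by move=> eH xe ye; exists y; split=> //; right; exists e. Qed.

Lemma reach_sym r x y : reach r x y -> reach r y x.
Proof.
elim: r x => [|r IH] x /=; first by move=> ->.
move=> [u [xu uy]]; suff : reach (r + 1) y x by rewrite addn1.
apply: reach_trans (IH _ uy) _; case: xu => [->|[e [eH xe ue]]]; first exact: reach_refl.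
exact: reach_edge eH ue xe.
Qed.

Lemma far_sym r U1 U2 : far r U1 U2 -> far r U2 U1.
Proof. by move=> f x y xU yU /reach_sym; exact: f. Qed.

Lemma far_edge r U1 U2 e z : far r.+1 U1 U2 -> e \in H -> z \in e -> z \in U1 ->
  far r (U1 :|: e) U2.
Proof.
move=> f eH ze zU x y; rewrite finset.in_setU => /orP[xU|xe] yU xy.
  by apply: (f x y) => //; apply: reach_mono xy.
by apply: (f z y) => //; exists x; split=> //; right; exists e.
Qed.

(** The hypergraph looks like a tree of large degrees around [(U, F)]: an edge
    outside [F] that meets [U] does so in one vertex, and this persists when the
    edge is absorbed. The recursion on single edges replaces a condition on all
    connected sets of at most [s] edges attached to [U], and is what the game
    consumes, one edge at a time. *)
Fixpoint tame s U F : Prop :=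
  if s is s'.+1 then
    forall e z, e \in H -> e \notin F -> z \in e -> z \in U ->
      [/\ #|e :&: U| = 1, (forall x, x \in e -> s' < #|star x|)
        & tame s' (U :|: e) (e |: F)]
  else True.

Lemma tame_mono s s' U F : s <= s' -> tame s' U F -> tame s U F.
Proof.
elim: s s' U F => [|s IH] [|s'] U F //=.
rewrite ltnS => ss' tm e z eH eF ze zU.
have [c dg tm'] := tm e z eH eF ze zU; split=> //.
  by move=> x /dg; apply: leq_ltn_trans.
exact: IH tm'.
Qed.

(** No short path joins the two parts, so the edges that can be attached within
    [s] steps are attached to only one of them. *)
Lemma tame_union s U1 U2 F1 F2 : tame s U1 F1 -> tame s U2 F2 -> far s U1 U2 ->
  tame s (U1 :|: U2) (F1 :|: F2).
Proof.
elim: s U1 U2 F1 F2 => [|s IH] // U1 U2 F1 F2.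
have half V1 V2 G1 G2 e z : tame s.+1 V1 G1 -> tame s.+1 V2 G2 ->
    far s.+1 V1 V2 -> e \in H -> e \notin G1 -> z \in e -> z \in V1 ->
    [/\ #|e :&: (V1 :|: V2)| = 1, (forall x, x \in e -> s < #|star x|)
        & tame s ((V1 :|: V2) :|: e) (e |: (G1 :|: G2))].
  move=> t1 t2 f eH eG ze zV; have [c dg t'] := t1 e z eH eG ze zV; split=> //.
    have -> : e :&: (V1 :|: V2) = e :&: V1; last by [].
    apply/setP => y; rewrite !inE; have [ye|] //= := boolP (y \in e).
    have [yV|] := boolP (y \in V2); last by rewrite orbF.
    by case: (f z y zV yV); apply: (@reach_mono 1) => //; apply: reach_edge ze ye.
  rewrite finset.setUAC finset.setUA; apply: IH => //.
  - exact: tame_mono t2.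
  - exact: far_edge zV.
move=> t1 t2 f e z eH; rewrite !inE negb_or => /andP[eF1 eF2] ze /orP[zU|zU].
  exact: half zU.
rewrite (finset.setUC U1) (finset.setUC F1); apply: half zU => //; exact: far_sym.
Qed.

(** A short path from [U1] to [U2] would, edge by edge, enter the set already
    absorbed in a single vertex, and its last edge would enter it in two. *)
Lemma tame_split s U1 U2 F1 F2 : tame s (U1 :|: U2) (F1 :|: F2) ->
    U1 :&: U2 = finset.set0 -> (forall e, e \in F1 -> e \subset U1) ->
    (forall e, e \in F2 -> e \subset U2) ->
  tame s U1 F1 /\ far s U1 U2.
Proof.
elim: s U1 F1 => [|s IH] U1 F1 tm dis sF1 sF2.
  by split=> // x y xU yU /= xy; have := finset.in_set0 x; rewrite -dis inE xU xy yU.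
have disP x : x \in U1 -> x \in U2 -> False.
  by move=> x1 x2; have := finset.in_set0 x; rewrite -dis inE x1 x2.
have step e z : e \in H -> e \notin F1 -> z \in e -> z \in U1 ->
    [/\ #|e :&: U1| = 1, (forall x, x \in e -> s < #|star x|) ,
       tame s (U1 :|: e) (e |: F1) & far s (U1 :|: e) U2].
  move=> eH eF ze zU.
  have eF2 : e \notin F2.
    by apply/negP => /sF2 /fintype.subsetP /(_ _ ze); exact: disP zU.
  have [||c dg t'] := tm e z eH _ ze; rewrite ?inE ?negb_or ?eF ?zU //.
  have zE : e :&: (U1 :|: U2) = [set z].
    apply/eqP; rewrite eq_sym eqEcard finset.sub1set !inE ze zU cards1 c //.
  have eU1 : e :&: U1 = [set z].
    apply/eqP; rewrite finset.eqEsubset finset.sub1set !inE ze zU -zE.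
    by apply/andP; split=> //; apply/fintype.subsetP => y; rewrite !inE => /andP[-> ->].
  rewrite eU1 cards1.
  have [] := IH (U1 :|: e) (e |: F1) => //.
  - by rewrite finset.setUAC -(finset.setUA [set e]).
  - apply/setP => y; rewrite !inE; apply/negP => /andP[/orP[y1|ye] y2].
      exact: disP y1 y2.
    have : y \in e :&: (U1 :|: U2) by rewrite !inE ye y2 orbT.
    by rewrite zE inE => /eqP yz; apply: (disP z) => //; rewrite -yz.
  - move=> e'; rewrite !inE => /orP[/eqP->|/sF1 s1]; first exact: finset.subsetUr.
    by apply: fintype.subset_trans s1 _; exact: finset.subsetUl.
split.
  by move=> e z eH eF ze zU; have [] := step e z eH eF ze zU.
have [_ fs] := IH U1 F1 (tame_mono (leqnSn s) tm) dis sF1 sF2.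
move=> x y xU yU [z [[<-|[e [eH xe ze]]] zy]]; first exact: fs zy.
have [eF|eF] := boolP (e \in F1).
  by apply: fs zy => //; apply: (fintype.subsetP (sF1 _ eF)).
have [_ _ _ f'] := step e x eH eF xe xU.
by apply: f' zy => //; rewrite inE ze orbT.
Qed.

End Configurations.

(** * Configurations and their hulls *)

Section Growth.
Local Open Scope set_scope.
Local Open Scope nat_scope.

Variables (d : nat) (T : finType) (H : {set {set T}}).
Hypothesis Hunif : forall e, e \in H -> #|e| = d.+1.

Implicit Types (U W e : {set T}) (F : {set {set T}}) (x y z : T).

(** The vertices of [W] are complete: [F] contains all their edges. Such
    vertices have bounded degree, whence the cost of each of them in the expected
    number of configurations. *)
Definition config U F W : Prop :=
  [/\ F \subset H, (forall e, e \in F -> e \subset U), W \subset U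
    & forall w e, w \in W -> e \in H -> w \in e -> e \in F].

Definition generic s U F W : Prop :=
  [/\ config U F W, (forall u, u \in U -> u \notin W -> s < #|star H u|)
    & tame H s U F].

Lemma generic_mono s s' U F W : s <= s' -> generic s' U F W -> generic s U F W.
Proof.
move=> ss' [c dg tm]; split=> //; last exact: tame_mono tm.
by move=> u uU uW; apply: leq_ltn_trans ss' (dg u uU uW).
Qed.

(** The second clause says that at most [d] vertices are added for each new edge,
    so [d * #|F| - #|U|] does not decrease. The radius [r] bounds both the number
    of new vertices and their distance to the old ones. *)
Definition grows r U F W U' F' W' : Prop :=
  [/\ [/\ U \subset U', F \subset F' & W \subset W'],
      #|U'| + d * #|F| <= #|U| + d * #|F'|,
      #|U'| <= #|U| + d * r
    & forall u', u' \in U' -> exists2 u, u \in U & reach H r u u'].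

Lemma grows_trans r r' U F W U' F' W' U2 F2 W2 :
  grows r U F W U' F' W' -> grows r' U' F' W' U2 F2 W2 ->
  grows (r + r') U F W U2 F2 W2.
Proof.
move=> [[a1 a2 a3] b c n] [[a1' a2' a3'] b' c' n']; split.
- by split; [move: a1'|move: a2'|move: a3']; exact: fintype.subset_trans.
- lia.
- lia.
- move=> u2 /n'[u' /n[u uU uu'] u'u2]; exists u => //; exact: reach_trans u'u2.
Qed.

Lemma grows_mono r r' U F W U' F' W' : r <= r' ->
  grows r U F W U' F' W' -> grows r' U F W U' F' W'.
Proof.
move=> rr' [a b c n]; split=> //; first by apply: leq_trans c _; nia.
by move=> u' /n[u uU uu']; exists u => //; apply: reach_mono uu'.
Qed.

Lemma card_setD_edge U e z : e \in H -> z \in e -> z \in U -> #|e :\: U| <= d.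
Proof.
move=> eH ze zU; rewrite -ltnS -(Hunif eH); apply: proper_card.
apply/properP; split; first exact: finset.subsetDl.
by exists z => //; rewrite inE zU.
Qed.

(** Each new edge meets [U], hence adds at most [d] vertices. *)
Lemma grows_edges U F W W' (D : {set {set T}}) :
    (forall e, e \in F -> e \subset U) -> D \subset H ->
    (forall e, e \in D -> exists2 z, z \in e & z \in U) -> W \subset W' ->
  grows #|D|.+1 U F W (U :|: finset.cover D) (F :|: D) W'.
Proof.
move=> FU DH DU WW'.
have cU : U :|: finset.cover D = U :|: finset.cover [set e :\: U | e in D :\: F].
  apply/setP => x; rewrite !inE; have [//|xU] /= := boolP (x \in U).
  apply/finset.bigcupP/finset.bigcupP => [[e eD xe]|[e' /imsetP[e]]].
    exists (e :\: U); last by rewrite !inE xU.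
    apply/imsetP; exists e => //; rewrite !inE eD andbT.
    by apply: contra xU => /FU/fintype.subsetP; apply.
  by rewrite inE => /andP[_ eD] ->; rewrite inE => /andP[_ xe]; exists e.
have cD : #|finset.cover [set e :\: U | e in D :\: F]| <= d * #|D :\: F|.
  apply: leq_trans (leq_card_cover _) _; rewrite mulnC.
  apply: (@leq_trans (#|[set e :\: U | e in D :\: F]| * d)); last first.
    by rewrite leq_mul2r leq_imset_card orbT.
  rewrite -sum_nat_const; apply: leq_sum => e' /imsetP[e].
  rewrite inE => /andP[_ eD] ->; have [z ze zU] := DU e eD.
  exact: card_setD_edge (fintype.subsetP DH _ eD) ze zU.
have cF : #|F :|: D| = #|F| + #|D :\: F|.
  rewrite -cardsUI; have -> : F :&: (D :\: F) = finset.set0.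
    by apply/setP => e; rewrite !inE; case: (e \in F).
  rewrite cards0 addn0; congr #|pred_of_set _|.
  by apply/setP => e; rewrite !inE; case: (e \in F).
have cUD : #|U :|: finset.cover D| <= #|U| + d * #|D :\: F|.
  by rewrite cU; apply: leq_trans (leq_card_setU _ _) _; rewrite leq_add2l.
split.
- by split=> //; apply: finset.subsetUl.
- by rewrite cF mulnDr; lia.
- apply: leq_trans cUD _; rewrite leq_add2l leq_mul2l; apply/orP; right.
  by apply: leq_trans (subset_leq_card (finset.subsetDl D F)) _.
- move=> u; rewrite inE => /orP[uU|/finset.bigcupP[e eD ue]].
    by exists u => //; apply: reach_refl.
  have [z ze zU] := DU e eD; exists z => //; apply: (@reach_mono _ _ 1) => //.
  exact: reach_edge (fintype.subsetP DH _ eD) ze ue.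
Qed.

Lemma config_add_edge U F W e z : config U F W -> e \in H -> z \in e ->
  z \in U -> config (U :|: e) (e |: F) W /\ grows 2 U F W (U :|: e) (e |: F) W.
Proof.
move=> [FH FU WU WF] eH ze zU; split.
  split.
  - by rewrite finset.subUset finset.sub1set eH FH.
  - move=> e'; rewrite !inE => /orP[/eqP->|/FU s]; first exact: finset.subsetUr.
    by apply: fintype.subset_trans s _; exact: finset.subsetUl.
  - by apply: fintype.subset_trans WU _; exact: finset.subsetUl.
  - by move=> w e' wW e'H we'; rewrite inE (WF w e') ?orbT.
rewrite (finset.setUC [set e]).
have -> : U :|: e = U :|: finset.cover [set e] by rewrite /finset.cover big_set1.
rewrite -[2]/1.+1 -(cards1 e); apply: grows_edges => //.
  by rewrite finset.sub1set.
by move=> e' /set1P ->; exists z.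
Qed.

(** A vertex of small degree is made complete by adding all its edges. *)
Lemma config_saturate t U F W x : config U F W -> x \in U -> x \notin W ->
    #|star H x| <= t ->
  exists U' F' W', [/\ config U' F' W', grows t.+1 U F W U' F' W' & #|W| < #|W'|].
Proof.
move=> [FH FU WU WF] xU xW dg.
exists (U :|: finset.cover (star H x)), (F :|: star H x), (x |: W); split.
- split.
  + rewrite finset.subUset FH; apply/fintype.subsetP => e.
    by rewrite inE => /andP[].
  + move=> e; rewrite inE => /orP[/FU s|es].
      by apply: fintype.subset_trans s _; exact: finset.subsetUl.
    by apply: fintype.subset_trans (finset.subsetUr _ _); exact: finset.bigcup_sup.
  + rewrite finset.subUset finset.sub1set inE xU.
    by apply: fintype.subset_trans WU _; exact: finset.subsetUl.
  + move=> w e; rewrite !inE => /orP[/eqP->|wW] eH we.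
      by rewrite eH we orbT.
    by rewrite (WF w e).
- apply: (@grows_mono #|star H x|.+1) => //; apply: grows_edges => //.
  + by apply/fintype.subsetP => e; rewrite inE => /andP[].
  + by move=> e; rewrite inE => /andP[_ xe]; exists x.
  + exact: finset.subsetUr.
- by rewrite cardsU1 xW.
Qed.

(** The weight [d * #|F| - #|U| + #|W|] strictly increases: a cycle has been
    closed or a complete vertex has been added. *)
Definition improves r U F W U' F' W' : Prop :=
  grows r U F W U' F' W' /\
  #|U'| + d * #|F| + #|W| < #|U| + d * #|F'| + #|W'|.

Lemma not_tame_improves t U F W : config U F W -> ~ tame H t U F ->
  exists U' F' W', config U' F' W' /\ improves (t.*2.+1) U F W U' F' W'.
Proof.
elim: t U F => [|t IH] U F cf ntm; first by case: ntm.
have [e [z [eH eF ze zU nt]]] : exists e z, [/\ e \in H, e \notin F, z \in e,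
    z \in U & ~ [/\ #|e :&: U| = 1, (forall x, x \in e -> t < #|star H x|)
        & tame H t (U :|: e) (e |: F)]].
  apply/not_existsP => ne; apply: ntm => e z eH eF ze zU.
  by apply: contrapT => nt; apply: (ne e); exists z.
have [cf1 gr1] := config_add_edge cf eH ze zU.
have cF : #|e |: F| = #|F|.+1 by rewrite cardsU1 eF.
have [c1|c1] := eqVneq #|e :&: U| 1; last first.
  exists (U :|: e), (e |: F), W; split=> //; split.
    by apply: grows_mono gr1; rewrite doubleS.
  have c2 : 1 < #|e :&: U|.
    rewrite ltn_neqAle eq_sym c1 /=; apply/card_gt0P.
    by exists z; rewrite inE ze zU.
  have cU : #|e :&: U| <= #|U| by apply: subset_leq_card; exact: finset.subsetIr.
  by rewrite cF cardsU (Hunif eH) (finset.setIC U) mulnS; lia.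
(* failure by a vertex [x] of small degree on [e]; as [e] is not in [F], [x] is
   not in [W], and completing it enlarges [W] *)
have [[x [xe dg]]|nx] := pselect (exists x, x \in e /\ #|star H x| <= t).
  have xW : x \notin W.
    by apply/negP => xW; have [_ _ _ /(_ x e xW eH xe)] := cf; apply/negP.
  have xU : x \in U :|: e by rewrite inE xe orbT.
  have [U' [F' [W' [cf' gr' lW]]]] := config_saturate cf1 xU xW dg.
  exists U', F', W'; split=> //; split.
    by apply: grows_mono (grows_trans gr1 gr'); rewrite doubleS -addnn; lia.
  by have [_ b _ _] := grows_trans gr1 gr'; lia.
have ntm' : ~ tame H t (U :|: e) (e |: F).
  move=> tm; apply: nt; split=> // x xe; rewrite ltnNge; apply/negP => dg.
  by apply: nx; exists x.
have [U' [F' [W' [cf' [gr' lt']]]]] := IH _ _ cf1 ntm'.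
exists U', F', W'; split=> //; split.
  by apply: grows_mono (grows_trans gr1 gr'); rewrite doubleS; lia.
by have [_ b _ _] := gr1; lia.
Qed.

Lemma not_generic_improves t U F W : config U F W -> ~ generic t U F W ->
  exists U' F' W', config U' F' W' /\ improves (t.*2.+1) U F W U' F' W'.
Proof.
move=> cf ng; have [tm|] := pselect (tame H t U F); last exact: not_tame_improves.
have [[x [xU xW dg]]|nx] :=
    pselect (exists x, [/\ x \in U, x \notin W & #|star H x| <= t]).
  have [U' [F' [W' [cf' gr' lW]]]] := config_saturate cf xU xW dg.
  exists U', F', W'; split=> //; split.
    by apply: grows_mono gr'; rewrite ltnS -addnn leq_addr.
  by have [_ b _ _] := gr'; lia.
case: ng; split=> // u uU uW; rewrite ltnNge; apply/negP => dg.
by apply: nx; exists u.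
Qed.

Variable dense : nat -> nat -> nat -> Prop.

(** [dense] is a predicate on the numbers of vertices, edges and complete
    vertices; it will hold of the shapes whose expected number vanishes. *)
Definition sparse K : Prop := forall U F W, config U F W -> #|U| <= K ->
  ~ dense #|U| #|F| #|W|.

(** Size bound after [j] improvements, when genericity is required at the level
    [lvl c] for a configuration of size at most [c]. *)
Fixpoint hull_size (lvl : nat -> nat) j : nat :=
  if j is j'.+1 then
    let c := hull_size lvl j' in c + d.+1 * (lvl c).*2.+1
  else 1.

Lemma hull_size_homo lvl j j' : j <= j' -> hull_size lvl j <= hull_size lvl j'.
Proof.
elim: j' => [|j' IH]; first by rewrite leqn0 => /eqP->.
rewrite leq_eqVlt => /orP[/eqP->//|/IH h]; apply: leq_trans h _ => /=.
exact: leq_addr.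
Qed.

(** Improve the configuration reduced to [x] until it is generic. As the weight
    [d * #|F| + 1 - #|U| + #|W|] increases at each step and configurations of
    weight more than [M] are dense, there are at most [M] steps. The level of
    genericity may grow with the size reached so far, which lets the game ask for
    a level that depends on the hull. *)
Lemma hull_exists (lvl : nat -> nat) M K x :
    (forall v e m : nat, 0 < v -> v <= d * e + 1 -> M < d * e + 1 - v + m ->
      dense v e m) ->
    sparse K -> hull_size lvl M.+1 <= K ->
  exists j U F W, [/\ j <= M, x \in U, #|U| <= hull_size lvl j,
    generic (lvl (hull_size lvl j)) U F W
    & forall u, u \in U -> reach H (hull_size lvl j) x u].
Proof.
move=> Hd sp hK.
suff main k : forall j U F W, j + k = M.+1 -> config U F W -> x \in U ->
    #|U| <= hull_size lvl j -> (forall u, u \in U -> reach H (hull_size lvl j) x u) ->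
    #|U| <= d * #|F| + 1 -> j <= d * #|F| + 1 - #|U| + #|W| ->
  exists j U F W, [/\ j <= M, x \in U, #|U| <= hull_size lvl j,
    generic (lvl (hull_size lvl j)) U F W
    & forall u, u \in U -> reach H (hull_size lvl j) x u].
  apply: (main M.+1 0 [set x] finset.set0 finset.set0) => //.
  - split.
    + exact: finset.sub0set.
    + by move=> e; rewrite inE.
    + exact: finset.sub0set.
    + by move=> w e; rewrite inE.
  - by rewrite inE.
  - by rewrite cards1.
  - by move=> u /set1P ->; apply: reach_refl.
  - by rewrite cards1 addn1.
elim: k => [|k IH] j U F W jk.
  have -> : j = M.+1 by rewrite -jk addn0.
  move=> cf xU cU _ cF lj; exfalso; apply: (sp _ _ _ cf).
    exact: leq_trans cU hK.
  have U0 : 0 < #|U| by apply/card_gt0P; exists x.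
  exact: Hd.
move=> cf xU cU nU cF lj.
have [ge|nge] := pselect (generic (lvl (hull_size lvl j)) U F W).
  by exists j, U, F, W; split=> //; lia.
have [U' [F' [W' [cf' [gr' lt']]]]] := not_generic_improves cf nge.
have [[sU sF sW] b c n] := gr'.
apply: (IH j.+1 U' F' W') => //.
- by lia.
- exact: (fintype.subsetP sU).
- by apply: leq_trans c _; rewrite /=; nia.
- move=> u' /n[u uU uu']; apply: reach_mono (reach_trans (nU u uU) uu') => /=.
  by rewrite leq_add2l; nia.
- by move: (subset_leq_card sF); nia.
- by lia.
Qed.

End Growth.

(** * Patterns and their occurrences *)

Section Patterns.
Local Open Scope set_scope.
Local Open Scope nat_scope.

Definition edge_image (V T : finType) (f : V -> T) (S : {set {set V}}) :
    {set {set T}} :=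
  [set [set f x | x in (e : {set V})] | e in S].

Lemma edge_image_comp (V V' T : finType) (f : V -> V') (g : V' -> T) S :
  edge_image g (edge_image f S) = edge_image (g \o f) S.
Proof.
rewrite /edge_image -imset_comp; apply: eq_imset => e /=.
by rewrite -imset_comp.
Qed.

Lemma eq_edge_image (V T : finType) (f g : V -> T) S :
  f =1 g -> edge_image f S = edge_image g S.
Proof. by move=> fg; apply: eq_imset => e; apply: eq_imset. Qed.

Lemma edge_imageU (V T : finType) (f : V -> T) S1 S2 :
  edge_image f (S1 :|: S2) = edge_image f S1 :|: edge_image f S2.
Proof. exact: imsetU. Qed.

Lemma card_edge_image (V T : finType) (f : V -> T) S :
  injective f -> #|edge_image f S| = #|S|.
Proof. by move=> fI; apply: card_imset; apply: imset_inj. Qed.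

Lemma mem_edge_image (V T : finType) (f : V -> T) (S : {set {set V}}) (e : {set V}) :
  injective f -> (f @: e \in edge_image f S) = (e \in S).
Proof. by move=> fI; rewrite mem_imset //; apply: imset_inj. Qed.

Lemma edge_image_inP (V T : finType) (f : V -> T) (S : {set {set V}}) (e : {set T}) x :
  injective f -> e \in edge_image f S -> f x \in e ->
  exists2 e', e' \in S & e = f @: e' /\ x \in e'.
Proof.
move=> fI /imsetP[e' e'S ->]; rewrite mem_imset // => xe'.
by exists e'.
Qed.

Definition occurs (V T : finType) (H : {set {set T}}) S (W : {set V}) (f : V -> T) : Prop :=
  injective f /\ config H (f @: [set: V]) (edge_image f S) (f @: W).

Definition occurs_generically (V T : finType) (H : {set {set T}}) s S (W : {set V})
    (f : V -> T) : Prop :=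
  injective f /\ generic H s (f @: [set: V]) (edge_image f S) (f @: W).

Lemma occurs_generically_mono (V T : finType) (H : {set {set T}}) s s' S (W : {set V})
    (f : V -> T) : s <= s' ->
  occurs_generically H s' S W f -> occurs_generically H s S W f.
Proof. by move=> ss' [fI g]; split=> //; exact: generic_mono g. Qed.

Lemma occurs_genericallyW (V T : finType) (H : {set {set T}}) s S (W : {set V})
    (f : V -> T) : occurs_generically H s S W f -> occurs H S W f.
Proof. by move=> [fI [c _ _]]; split. Qed.

(** Any parametrization of [U] turns a configuration into an occurrence of a
    pattern, so patterns need only be considered up to the choice of their vertex
    type. *)
Lemma config_pullback (V T : finType) (H : {set {set T}}) U F W (f : V -> T) :
    f @: [set: V] = U -> config H U F W ->
  exists S (W' : {set V}), edge_image f S = F /\ f @: W' = W.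
Proof.
move=> fU [FH FU WU WF].
have pre (X : {set T}) : X \subset U -> f @: (f @^-1: X) = X.
  move=> XU; apply/setP => x; apply/imsetP/idP => [[v]|xX].
    by rewrite inE => vX ->.
  have : x \in U by apply: (fintype.subsetP XU).
  by rewrite -fU => /imsetP[v _ xv]; exists v; rewrite // inE -xv.
exists [set e | f @: (e : {set V}) \in F], (f @^-1: W); split; last exact: pre.
apply/setP => e; apply/imsetP/idP => [[e']|eF]; first by rewrite inE => h ->.
by exists (f @^-1: e); rewrite ?inE pre // FU.
Qed.

Lemma enumerate (T : finType) (U : {set T}) :
  exists f : 'I_#|U| -> T, injective f /\ f @: [set: 'I_#|U|] = U.
Proof.
exists enum_val; split; first exact: enum_val_inj.
apply/setP => x; apply/imsetP/idP => [[i _ ->]|xU]; first exact: enum_valP.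
by exists (enum_rank_in xU x) => //; rewrite enum_rankK_in.
Qed.

Definition sum_map (V V' T : Type) (f : V -> T) (g : V' -> T) (x : V + V') : T :=
  match x with inl v => f v | inr v => g v end.

Lemma sum_map_inj (V V' T : finType) (f : V -> T) (g : V' -> T) :
    injective f -> injective g -> (forall v v', f v <> g v') ->
  injective (sum_map f g).
Proof.
move=> fI gI fg [v|v] [w|w] //= h; first by rewrite (fI _ _ h).
- by case: (fg _ _ h).
- by case: (fg _ _ (esym h)).
- by rewrite (gI _ _ h).
Qed.

Lemma sum_map_image (V V' T : finType) (f : V -> T) (g : V' -> T) :
  sum_map f g @: [set: V + V'] = f @: [set: V] :|: g @: [set: V'].
Proof.
apply/setP => x; rewrite inE; apply/imsetP/orP => [[[v|v] _ ->]|].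
- by left; apply: imset_f.
- by right; apply: imset_f.
- by move=> [/imsetP[v _ ->]|/imsetP[v _ ->]]; [exists (inl v)|exists (inr v)].
Qed.

Lemma extend_injection (V T : finType) (f : V -> T) (U : {set T}) k :
    injective f -> f @: [set: V] \subset U -> #|U| = #|V| + k ->
  exists g : 'I_k -> T, injective (sum_map f g) /\
    sum_map f g @: [set: V + 'I_k] = U.
Proof.
move=> fI fU cU; set D := U :\: f @: [set: V].
have cD : #|D| = k.
  rewrite cardsD (finset.setIidPr _); last by [].
  by rewrite card_imset // cardsT cU addKn.
rewrite -{k cU}cD; have [g [gI gD]] := enumerate D.
exists g; split.
  apply: sum_map_inj => // v i fg.
  have : g i \in D by rewrite -gD imset_f.
  by rewrite -fg inE imset_f.
rewrite sum_map_image gD; apply/setP => x; rewrite inE [x \in D]inE.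
have [xf|//] := boolP (x \in f @: _).
by rewrite (fintype.subsetP fU).
Qed.

Lemma config_union (T : finType) (H : {set {set T}}) U1 U2 F1 F2 W1 W2 :
    config H U1 F1 W1 -> config H U2 F2 W2 ->
  config H (U1 :|: U2) (F1 :|: F2) (W1 :|: W2).
Proof.
move=> [a1 b1 c1 e1] [a2 b2 c2 e2]; split.
- by rewrite finset.subUset a1 a2.
- move=> e; rewrite inE => /orP[/b1|/b2] s; apply: fintype.subset_trans s _.
    exact: finset.subsetUl.
  exact: finset.subsetUr.
- exact: finset.setUSS.
- move=> w e; rewrite !inE => /orP[wW|wW] eH we; first by rewrite (e1 w).
  by rewrite (e2 w) ?orbT.
Qed.

Lemma generic_union (T : finType) (H : {set {set T}}) s U1 U2 F1 F2 W1 W2 :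
    generic H s U1 F1 W1 -> generic H s U2 F2 W2 -> far H s U1 U2 ->
  generic H s (U1 :|: U2) (F1 :|: F2) (W1 :|: W2).
Proof.
move=> [c1 d1 t1] [c2 d2 t2] fr; split; first exact: config_union.
  move=> u; rewrite !inE negb_or => /orP[uU|uU] /andP[u1 u2]; first exact: d1.
  exact: d2.
exact: tame_union.
Qed.

Lemma occurs_generically_union (V1 V2 T : finType) (H : {set {set T}}) s
    S1 (W1 : {set V1}) S2 (W2 : {set V2}) (f1 : V1 -> T) (f2 : V2 -> T) :
    occurs_generically H s S1 W1 f1 -> occurs_generically H s S2 W2 f2 ->
    far H s (f1 @: [set: V1]) (f2 @: [set: V2]) ->
  occurs_generically H s (edge_image inl S1 :|: edge_image inr S2)
    (inl @: W1 :|: inr @: W2) (sum_map f1 f2).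
Proof.
move=> [f1I g1] [f2I g2] fr; split.
  apply: sum_map_inj => // v1 v2 h; apply: (fr (f1 v1) (f1 v1)).
  - exact: imset_f.
  - by rewrite h imset_f.
  - exact: reach_refl.
rewrite sum_map_image edge_imageU !edge_image_comp imsetU -!imset_comp.
rewrite (eq_edge_image S1 (_ : _ =1 f1)) // (eq_edge_image S2 (_ : _ =1 f2)) //.
rewrite (eq_imset W1 (_ : _ =1 f1)) // (eq_imset W2 (_ : _ =1 f2)) //.
exact: generic_union.
Qed.

End Patterns.

(** * Extending an occurrence along a path *)

Section Extension.
Local Open Scope set_scope.
Local Open Scope nat_scope.
Variable d : nat.

Definition uniform (T : finType) (H : {set {set T}}) :=
  forall e, e \in H -> #|e| = d.+1.

(** The pattern [S] with one more edge, which contains the vertex [y] and [d] new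
    vertices. *)
Definition pendant_edges (V : finType) (S : {set {set V}}) (y : V) :
    {set {set (V + 'I_d)}} :=
  (inl y |: inr @: [set: 'I_d]) |: edge_image inl S.

(** One level of genericity is spent for each edge added. *)
Lemma generic_add_edge (T : finType) (H : {set {set T}}) s U F W e z :
    uniform H -> generic H s.+1 U F W -> e \in H -> e \notin F -> z \in e ->
    z \in U ->
  e :&: U = [set z] /\ generic H s (U :|: e) (e |: F) W.
Proof.
move=> Hu [cf dg tm] eH eF ze zU.
have [c1 de t'] := tm e z eH eF ze zU; split.
  apply/eqP; rewrite eq_sym eqEcard c1 cards1 leqnn andbT.
  by rewrite finset.sub1set inE ze zU.
split=> //; first by have [] := config_add_edge Hu cf eH ze zU.
move=> u; rewrite inE => /orP[uU uW|/de//].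
by apply: leq_ltn_trans (dg u uU uW).
Qed.

Lemma occurs_generically_add_edge (V T : finType) (H : {set {set T}}) s S
    (W : {set V}) (f : V -> T) e y :
    uniform H -> occurs_generically H s.+1 S W f -> e \in H ->
    e \notin edge_image f S -> f y \in e ->
  exists g : 'I_d -> T,
    occurs_generically H s (pendant_edges S y) (inl @: W) (sum_map f g) /\
    e \subset sum_map f g @: [set: V + 'I_d].
Proof.
move=> Hu [fI ge] eH eS ye; set U := f @: [set: V] in ge.
have yU : f y \in U by apply: imset_f.
have [eU ge'] := generic_add_edge Hu ge eH eS ye yU.
have [||g [gI gU]] := @extend_injection V T f (U :|: e) d fI.
- exact: finset.subsetUl.
- by rewrite cardsU (Hu e eH) finset.setIC eU cards1 card_imset // cardsT addnS subn1.
exists g; split; last by rewrite gU; exact: finset.subsetUr.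
split=> //; rewrite gU.
have -> : sum_map f g @: (inl @: W) = f @: W.
  by rewrite -imset_comp; apply: eq_imset.
have -> // : edge_image (sum_map f g) (pendant_edges S y) = e |: edge_image f S.
rewrite /pendant_edges edge_imageU edge_image_comp; congr (_ :|: _).
rewrite /edge_image imset_set1; congr [set _].
rewrite imsetU imset_set1 /= -imset_comp.
apply/setP => x; rewrite !inE; apply/idP/idP => [/orP[/eqP->//|/imsetP[i _ xi]]|xe].
  have : x \in U :|: e by rewrite -gU; apply/imsetP; exists (inr i).
  rewrite inE => /orP[/imsetP[v _ xv]|//].
  have : sum_map f g (inl v) = sum_map f g (inr i) by exact: etrans (esym xv) xi.
  by move/gI.
have [//|xy] /= := eqVneq x (f y).
have : x \in U :|: e by rewrite inE xe orbT.
rewrite -gU => /imsetP[[v|i] _ xv]; last by rewrite xv; apply: (imset_f (sum_map f g \o inr)).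
have : x \in e :&: U by rewrite inE xe xv /= imset_f.
by rewrite eU inE (negbTE xy).
Qed.

(** An incomplete vertex has more edges than the pattern, so one of them is new. *)
Lemma incomplete_edge (V T : finType) (H : {set {set T}}) s S (W : {set V})
    (f : V -> T) y :
    occurs_generically H s S W f -> y \notin W -> #|S| <= s ->
  exists e, [/\ e \in H, e \notin edge_image f S & f y \in e].
Proof.
move=> [fI [cf dg _]] yW Ss.
have lt : #|edge_image f S| < #|star H (f y)|.
  rewrite card_edge_image //; apply: leq_ltn_trans Ss _; apply: dg.
    exact: imset_f.
  by rewrite mem_imset.
have /fintype.subsetPn[e] : ~~ (star H (f y) \subset edge_image f S).
  by apply: contraL lt => /subset_leq_card; rewrite -leqNgt.
by rewrite inE => /andP[eH ye] eS; exists e.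
Qed.

Lemma card_edges_bound (V : finType) (S : {set {set V}}) : #|S| <= 2 ^ #|V|.
Proof.
apply: leq_trans (max_card _) _.
by rewrite -cardsT -powersetT card_powerset cardsT.
Qed.

(** The answer to a move at distance at most [r]. A path from [f y] to [x] is
    followed edge by edge; each edge that leaves the pattern is pendant in [H], and
    is matched by any new edge of [H'] at the corresponding vertex, since a new
    edge at a generic occurrence is pendant too. *)
Lemma reach_extension r s (T T' : finType) (H : {set {set T}})
    (H' : {set {set T'}}) : uniform H -> uniform H' ->
  forall (V : finType) S (W : {set V}) (f : V -> T) (f' : V -> T') y x,
    2 ^ (#|V| + d * r) <= s ->
    occurs_generically H (r + s) S W f ->
    occurs_generically H' (r + s) S W f' -> reach H r (f y) x ->
  exists (V' : finType) (j : V -> V') S' (W' : {set V'}) (g : V' -> T)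
    (g' : V' -> T') x',
    [/\ #|V'| <= #|V| + d * r, occurs_generically H s S' W' g,
        occurs_generically H' s S' W' g', (forall v, g (j v) = f v /\ g' (j v) = f' v)
      & g x' = x].
Proof.
move=> Hu Hu'; elim: r => [|r IH] V S W f f' y x bs of1 of2.
  move=> /= yx; exists V, id, S, W, f, f', y; split=> //; lia.
move=> [z [yz zx]].
have bs' : 2 ^ (#|V| + d * r) <= s.
  by apply: leq_trans bs; rewrite leq_exp2l // leq_add2l leq_mul2l leqnSn orbT.
have stay v : reach H r (f v) x ->
  exists (V' : finType) (j : V -> V') S' (W' : {set V'}) (g : V' -> T)
    (g' : V' -> T') x',
    [/\ #|V'| <= #|V| + d * r.+1, occurs_generically H s S' W' g,
        occurs_generically H' s S' W' g', (forall v, g (j v) = f v /\ g' (j v) = f' v)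
      & g x' = x].
  move=> vx; have le : r + s <= r.+1 + s by rewrite leq_add2r.
  have [V' [j [S' [W' [g [g' [x' [c a1 a2 e12 e3]]]]]]]] := IH V S W f f' v x bs'
    (occurs_generically_mono le of1) (occurs_generically_mono le of2) vx.
  exists V', j, S', W', g, g', x'; split=> //; apply: leq_trans c _; nia.
case: yz => [yz|[e [eH ye ze]]]; first by apply: (stay y); rewrite yz.
have [eS|eS] := boolP (e \in edge_image f S).
  have [_ [[_ FU _ _] _ _]] := of1.
  have /imsetP[v _ zv] := fintype.subsetP (FU e eS) z ze.
  by apply: (stay v); rewrite -zv.
have yW : y \notin W.
  apply/negP => yW; have [_ [[_ _ _ WF] _ _]] := of1.
  by move: eS; rewrite (WF (f y) e) // imset_f.
have [|e' [eH' eS' ye']] := incomplete_edge of2 yW.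
  apply: leq_trans (card_edges_bound S) _.
  apply: (@leq_trans (2 ^ (#|V| + d * r))); first by rewrite leq_exp2l // leq_addr.
  by apply: leq_trans bs' _; apply: leq_addl.
have [h [oh he]] := occurs_generically_add_edge Hu of1 eH eS ye.
have [h' [oh' _]] := occurs_generically_add_edge Hu' of2 eH' eS' ye'.
have /imsetP[z' _ zz'] := fintype.subsetP he z ze.
have [||V' [j [S' [W' [g [g' [x' [c a1 a2 e12 e3]]]]]]]] :=
  IH (V + 'I_d)%type _ _ _ _ z' x _ oh oh'.
- by apply: leq_trans bs; rewrite leq_exp2l // card_sum card_ord mulnS addnA.
- by rewrite -zz'.
exists V', (j \o inl), S', W', g, g', x'; split=> //.
- by apply: leq_trans c _; rewrite card_sum card_ord; lia.
- by move=> v; have [/= -> ->] := e12 (inl v).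
Qed.

End Extension.

(** * Several copies of a pattern *)

Section Copies.
Local Open Scope set_scope.
Local Open Scope nat_scope.

Definition copy_edges k (V : finType) (S : {set {set V}}) :
    {set {set 'I_k * V}} :=
  finset.cover [set edge_image (fun v => (i, v)) S | i in [set: 'I_k]].

Definition copy_marks k (V : finType) (W : {set V}) : {set 'I_k * V} :=
  [set p | p.2 \in W].

Lemma copy_edgesP k (V : finType) (S : {set {set V}}) (e : {set 'I_k * V}) :
  reflect (exists i, exists2 e' : {set V}, e' \in S & e = [set (i, v) | v in e'])
    (e \in copy_edges k S).
Proof.
apply: (iffP finset.bigcupP) => [[F /imsetP[i _ ->] /imsetP[e' e'S ->]]|].
  by exists i, e'.
move=> [i [e' e'S ->]]; exists (edge_image (fun v => (i, v)) S).
  exact: imset_f.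
by apply/imsetP; exists e'.
Qed.

Lemma pair_inj k (V : finType) (i : 'I_k) : injective (fun v : V => (i, v)).
Proof. by move=> v w [->]. Qed.

(** Around a generic occurrence of disjoint copies, the copies are far from each
    other, since a path joining two of them would enter their union twice. *)
Lemma occurs_generically_copy k (V T : finType) (H : {set {set T}}) s S
    (W : {set V}) (f : 'I_k * V -> T) :
    occurs_generically H s (copy_edges k S) (copy_marks k W) f ->
    forall i,
  occurs_generically H s S W (fun v => f (i, v)) /\
  (forall j, i != j -> far H s ((fun v => f (i, v)) @: [set: V])
                                ((fun v => f (j, v)) @: [set: V])).
Proof.
move=> [fI [[FH FU WU WF] dg tm]] i.
pose fi v := f (i, v); have fiI : injective fi by move=> v w /fI[].
set U1 := fi @: [set: V]; set F1 := edge_image fi S.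
pose U2 := f @: [set p | p.1 != i].
pose F2 := [set e in edge_image f (copy_edges k S) | e \subset U2].
have F1U e : e \in F1 -> e \subset U1.
  by move=> /imsetP[e' _ ->]; apply: imsetS; exact: finset.subsetT.
have F1F e : e \in F1 -> e \in edge_image f (copy_edges k S).
  move=> /imsetP[e' e'S ->]; apply/imsetP; exists [set (i, v) | v in e'].
    by apply/copy_edgesP; exists i, e'.
  by rewrite -imset_comp.
have FE e : e \in edge_image f (copy_edges k S) -> e \in F1 \/ e \subset U2.
  move=> /imsetP[_ /copy_edgesP[j [e' e'S ->]] ->]; rewrite -imset_comp.
  have [->|ji] := eqVneq j i; first by left; apply/imsetP; exists e'.
  right; apply/fintype.subsetP => x /imsetP[v _ ->] /=.
  by apply: imset_f; rewrite inE.
have dis : U1 :&: U2 = finset.set0.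
  apply/setP => x; rewrite !inE; apply/negP => /andP[/imsetP[v _ ->]].
  by rewrite /U2 /fi mem_imset // inE eqxx.
have EU : f @: [set: 'I_k * V] = U1 :|: U2.
  apply/setP => x; rewrite inE; apply/imsetP/orP => [[[j v] _ ->]|].
    have [->|ji] := eqVneq j i; first by left; apply/imsetP; exists v.
    by right; apply: imset_f; rewrite inE.
  by move=> [/imsetP[v _ ->]|/imsetP[p _ ->]]; [exists (i, v)|exists p].
have EF : edge_image f (copy_edges k S) = F1 :|: F2.
  apply/setP => e; rewrite !inE; apply/idP/orP => [eF|].
    by case: (FE e eF) => [->|->]; [left|right; rewrite eF].
  by move=> [/F1F|/andP[]].
have F2U e : e \in F2 -> e \subset U2 by rewrite inE => /andP[].
move: tm; rewrite EU EF => /(@tame_split T H s U1 U2 F1 F2) /(_ dis F1U F2U) [tm fr].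
split.
  split=> //; split=> //.
    split=> //.
    - apply/fintype.subsetP => e /F1F; exact: (fintype.subsetP FH).
    - by apply: imsetS; exact: finset.subsetT.
    - move=> w e /imsetP[v vW ->] eH ve.
      have : e \in edge_image f (copy_edges k S).
        by apply: (WF (fi v)) => //; apply: imset_f; rewrite inE.
      case/FE => // /fintype.subsetP/(_ _ ve) vU.
      by have := finset.in_set0 (fi v); rewrite -dis inE vU imset_f.
  move=> u /imsetP[v _ ->]; rewrite mem_imset // => vW; apply: dg.
    exact: imset_f.
  by rewrite mem_imset // inE.
move=> j ij x y xU /imsetP[v _ ->]; apply: fr => //.
by apply: imset_f; rewrite inE eq_sym.
Qed.

Variables (dense rich : nat -> nat -> nat -> Prop) (d : nat).
Hypothesis dense_or_rich : forall v e m, 0 < v -> v <= d * e + 1 ->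
  dense v e m \/ rich v e m.
Hypothesis rich_add : forall v e m v' e' m', rich v e m -> rich v' e' m' ->
  rich (v + v') (e + e') (m + m').

(** The condition of the second moment method. The sub-patterns [(O, E, W')] are
    the possible intersections of two occurrences; they contain all the edges of
    [S] at the vertices of [W'], because these vertices are complete in both
    occurrences, and [config S] expresses exactly this. *)
Definition admissible (V : finType) (S : {set {set V}}) (W : {set V}) : Prop :=
  forall O E W', config S O E W' -> W' \subset W -> O != finset.set0 ->
    rich #|O| #|E| #|W'|.

(** A connected sub-pattern lies in a single copy, hence occurs in [H]; it is
    therefore not dense, and being connected it has at most [d e + 1] vertices, so
    it is rich. A general sub-pattern is a disjoint union of connected ones. In the
    proof the component of a vertex is obtained as a maximal set of edges [F] whose
    union with this vertex has at most [d * #|F| + 1] vertices: any further edge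
    that meets this union could be added to [F]. *)
Lemma admissible_copies k (V T : finType) (H : {set {set T}}) K S (W : {set V})
    (f : V -> T) :
    uniform d H -> sparse H dense K -> #|V| <= K -> occurs H S W f ->
  admissible (copy_edges k S) (copy_marks k W).
Proof.
have arith a b c : a <= b + 1 -> 0 < c -> a + d.+1 - c <= d + b + 1 by lia.
move=> Hu sp VK [fI [FH FU WU WF]] O.
have [n] := ubnP #|O|; elim: n O => // n IH O; rewrite ltnS => On E W' cf WW O0.
have [ES EO WO WE] := cf.
have /set0Pn[[i u] iuO] := O0.
have eS (e : {set V}) : e \in S -> #|e| = d.+1.
  move=> e_S; rewrite -(card_imset _ fI); apply: Hu.
  by apply: (fintype.subsetP FH); rewrite mem_edge_image.
have eE (e : {set 'I_k * V}) : e \in E ->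
    exists j, exists2 e' : {set V}, e' \in S & e = [set (j, v) | v in e'].
  by move=> /(fintype.subsetP ES)/copy_edgesP.
have cE (e : {set 'I_k * V}) : e \in E -> #|e| = d.+1.
  by move=> /eE[j [e' /eS <- ->]]; rewrite card_imset //; exact: pair_inj.
(* the component of [(i, u)], as a maximal tree-like or denser union of edges *)
pose UF (F : {set {set 'I_k * V}}) := (i, u) |: finset.cover F.
pose P (F : {set {set 'I_k * V}}) := [&& F \subset E, #|UF F| <= d * #|F| + 1
  & UF F \subset [set p | p.1 == i]].
have P0 : P finset.set0.
  rewrite /P /UF finset.sub0set /finset.cover big_set0 finset.setU0 cards1.
  by rewrite finset.sub1set inE /= eqxx addn1.
case: (@arg_maxnP _ finset.set0 P (fun F => #|F|) P0) => F /and3P[FE cF Fi] maxF.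
set U := UF F in cF Fi.
have FsU e : e \in F -> e \subset U.
  move=> eF; apply: fintype.subset_trans (finset.subsetUr _ _).
  exact: finset.bigcup_sup.
have closedF e p : e \in E -> p \in e -> p \in U -> e \in F.
  move=> e_E pe pU; apply/negPn/negP => eF.
  have [j [e' e'S ee']] := eE e e_E.
  have ji : j = i.
    move: pe; rewrite ee' => /imsetP[v _ pv].
    by have := fintype.subsetP Fi p pU; rewrite inE pv /= => /eqP.
  have UeF : UF (e |: F) = U :|: e.
    rewrite /U /UF /finset.cover -finset.setUA; congr (_ :|: _).
    by rewrite finset.bigcup_setU big_set1 finset.setUC.
  suff : P (e |: F) by move/maxF; rewrite /= cardsU1 eF add1n ltnn.
  apply/and3P; split.
  - by rewrite finset.subUset finset.sub1set e_E.
  - rewrite UeF cardsU1 eF cardsU (cE e e_E).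
    have : 0 < #|U :&: e| by apply/card_gt0P; exists p; rewrite inE pU.
    by rewrite add1n mulnS; exact: arith cF.
  - rewrite UeF finset.subUset Fi ee' ji; apply/fintype.subsetP => q /imsetP[v _ ->].
    by rewrite inE.
have UO : U \subset O.
  rewrite finset.subUset finset.sub1set iuO; apply/finset.bigcupsP => e eF.
  exact/EO/(fintype.subsetP FE).
have iuU : (i, u) \in U by rewrite inE finset.in_set1 eqxx.
have inj_snd : {in U &, injective (fun p => f p.2)}.
  move=> [j v] [j' v'] /(fintype.subsetP Fi) + /(fintype.subsetP Fi).
  by rewrite !inE /= => /eqP-> /eqP-> /fI ->.
have richU : rich #|U| #|F| #|W' :&: U|.
  have U0 : 0 < #|U| by apply/card_gt0P; exists (i, u).
  have [dn|//] := dense_or_rich #|W' :&: U| U0 cF.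
  exfalso; pose g (p : 'I_k * V) := f p.2.
  have cg : config H (g @: U) (edge_image g F) (g @: (W' :&: U)).
    have gE (e : {set 'I_k * V}) : e \in E -> exists2 e' : {set V}, e' \in S & g @: e = f @: e'.
      by move=> /eE[j [e' e'S ->]]; exists e'; rewrite // -imset_comp.
    split.
    - apply/fintype.subsetP => _ /imsetP[e eF ->].
      have [e' e'S ->] := gE e (fintype.subsetP FE _ eF).
      by apply: (fintype.subsetP FH); rewrite mem_edge_image.
    - by move=> _ /imsetP[e eF ->]; apply: imsetS; exact: FsU.
    - by apply: imsetS; exact: finset.subsetIr.
    - move=> _ e /imsetP[[j v] + ->] eH; rewrite inE => /andP[jvW jvU] ve.
      have vW : v \in W by have := fintype.subsetP WW _ jvW; rewrite inE.
      have /(edge_image_inP fI)/(_ ve) [e' e'S [ee' ve']] : e \in edge_image f S.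
        by apply: (WF (f v)) => //; exact: imset_f.
      have ij : j = i.
        by have := fintype.subsetP Fi _ jvU; rewrite inE => /eqP.
      apply/imsetP; exists [set (j, w) | w in e']; last by rewrite -imset_comp.
      have vj : (j, v) \in [set (j, w) | w in e'] by apply: imset_f.
      apply: closedF (vj) jvU; apply: (WE (j, v)) => //.
      by apply/copy_edgesP; exists j, e'.
  apply: (sp _ _ _ cg).
    by apply: leq_trans VK; rewrite -(card_imset _ fI); apply: subset_leq_card;
       apply/fintype.subsetP => _ /imsetP[p _ ->]; apply: imset_f.
  rewrite !card_in_imset //.
  - by move=> p q /finset.setIP[_ pU] /finset.setIP[_ qU]; exact: inj_snd.
  - move=> e1 e2 /FsU/fintype.subsetP s1 /FsU/fintype.subsetP s2 e12.
    apply/setP => p; apply/idP/idP => pe.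
      have : g p \in g @: e2 by rewrite -e12 imset_f.
      by move=> /imsetP[q qe gpq]; rewrite (inj_snd p q (s1 _ pe) (s2 _ qe) gpq).
    have : g p \in g @: e1 by rewrite e12 imset_f.
    by move=> /imsetP[q qe gpq]; rewrite (inj_snd p q (s2 _ pe) (s1 _ qe) gpq).
have [D0|D0] := eqVneq (O :\: U) finset.set0.
  have OU : O = U.
    by apply/eqP; rewrite finset.eqEsubset UO andbT -finset.setD_eq0 D0.
  have EF : E = F.
    apply/eqP; rewrite finset.eqEsubset FE andbT; apply/fintype.subsetP => e e_E.
    have /card_gt0P[p pe] : 0 < #|e| by rewrite cE.
    apply: (closedF e p e_E pe).
    by have := fintype.subsetP (EO _ e_E) p pe; rewrite OU.
  have WU' : W' :&: U = W' by apply/finset.setIidPl; rewrite -OU.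
  by rewrite EF; move: richU; rewrite WU' -OU.
have -> : #|O| = #|U| + #|O :\: U|.
  by rewrite -(cardsID U O) (finset.setIidPr UO).
have -> : #|E| = #|F| + #|E :\: F|.
  by rewrite -(cardsID F E) (finset.setIidPr FE).
rewrite -(cardsID U W'); apply: rich_add => //.
apply: IH => //.
- apply: leq_trans On; apply: proper_card; apply/properP; split.
    exact: finset.subsetDl.
  by exists (i, u) => //; rewrite inE iuU.
- split.
  + by apply: fintype.subset_trans ES; exact: finset.subsetDl.
  + move=> e; rewrite inE => /andP[eF e_E]; apply/fintype.subsetP => p pe.
    rewrite inE (fintype.subsetP (EO _ e_E)) // andbT.
    by apply: contra eF => pU; exact: closedF pU.
  + exact: finset.setSD.
  + move=> w e; rewrite !inE => /andP[wU wW] e_S we.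
    rewrite (WE w) // andbT; apply: contra wU => /FsU/fintype.subsetP /(_ w we).
    by rewrite !inE.
- by apply: fintype.subset_trans WW; exact: finset.subsetDl.
Qed.

End Copies.

(** * The Ehrenfeucht-Fraisse game *)

Section Game.
Local Open Scope set_scope.
Local Open Scope nat_scope.
Variables (d : nat) (dense rich : nat -> nat -> nat -> Prop).
Hypothesis d_gt0 : 0 < d.
Hypothesis dense_or_rich : forall v e m, 0 < v -> v <= d * e + 1 ->
  dense v e m \/ rich v e m.
Hypothesis rich_add : forall v e m v' e' m', rich v e m -> rich v' e' m' ->
  rich (v + v') (e + e') (m + m').
Variable M : nat.
Hypothesis excess_dense : forall v e m : nat, 0 < v -> v <= d * e + 1 ->
  M < d * e + 1 - v + m -> dense v e m.

Definition saturated (T : finType) (H : {set {set T}}) K : Prop :=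
  forall v (S : {set {set 'I_v}}) (W : {set 'I_v}), v <= K -> uniform d S ->
    admissible rich (copy_edges K S) (copy_marks K W) ->
    exists f : 'I_K * 'I_v -> T,
      occurs_generically H K (copy_edges K S) (copy_marks K W) f.

Definition good_model (T : finType) (H : {set {set T}}) K : Prop :=
  [/\ uniform d H, sparse H dense K & saturated H K].

(** An edge of [H] outside the pattern but inside its vertex set would meet that
    set in [d.+1 > 1] vertices. *)
Lemma occurs_generically_edge (V T : finType) (H : {set {set T}}) S
    (W : {set V}) (f : V -> T) (X : {set V}) :
  uniform d H -> occurs_generically H 1 S W f -> (f @: X \in H) = (X \in S).
Proof.
move=> Hu [fI [[FH _ _ _] _ tm]]; apply/idP/idP => [XH|XS]; last first.
  by apply: (fintype.subsetP FH); rewrite mem_edge_image.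
rewrite -(mem_edge_image S X fI); apply: contraT => XS.
have /card_gt0P[z zX] : 0 < #|f @: X| by rewrite (Hu _ XH).
have XU : f @: X \subset f @: [set: V] by apply: imsetS; exact: finset.subsetT.
have [c1 _ _] := tm _ z XH XS zX (fintype.subsetP XU _ zX).
move: c1; rewrite (finset.setIidPl XU) (Hu _ XH) => -[d0].
by move: d_gt0; rewrite d0.
Qed.

(** Pigeonhole: a vertex of [Y] cannot be near two copies, which are far apart. *)
Lemma far_copy (T V : finType) (H : {set {set T}}) K l (Y : {set T})
    (f : 'I_K * V -> T) :
    #|Y| < K -> l.*2 <= K ->
    (forall i j, i != j -> far H K ((fun v => f (i, v)) @: [set: V])
                                   ((fun v => f (j, v)) @: [set: V])) ->
  exists i, far H l Y ((fun v => f (i, v)) @: [set: V]).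
Proof.
move=> YK lK fr; apply: contrapT => nfar.
have near_i i : exists y, y \in Y /\ exists v, reach H l y (f (i, v)).
  apply: contrapT => ny; apply: nfar; exists i => y _ yY /imsetP[v _ ->] yv.
  by apply: ny; exists y; split=> //; exists v.
have [c Hc] := choice near_i.
have /injectivePn[i [j ij cij]] : ~~ injectiveb c.
  apply/negP => /injectiveP cI.
  have : #|c @: [set: 'I_K]| <= #|Y|.
    by apply: subset_leq_card; apply/fintype.subsetP => _ /imsetP[i _ ->]; case: (Hc i).
  by rewrite card_imset // cardsT card_ord leqNgt YK.
have [_ [v yv]] := Hc i; have [_ [w yw]] := Hc j.
apply: (fr i j ij (f (i, v)) (f (j, w))); try exact: (imset_f (fun v => f (_, v))).
apply: (reach_mono lK); rewrite -addnn; apply: reach_trans (reach_sym yv) _.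
by rewrite cij.
Qed.

Lemma env_cons_comp (V T : Type) m (g : V -> T) (x : V) (e : 'I_m -> V) :
  (fun i => g (env_cons x e i)) = env_cons (g x) (fun i => g (e i)).
Proof. by apply: functional_extensionality_dep => i; rewrite /env_cons; case: unlift. Qed.

Lemma sat_exP (T : finType) (H : {set {set T}}) m (phi : fo_formula d.+1 m.+1) e :
  reflect (exists x, fo_sat H phi (env_cons x e)) (fo_sat H (fo_ex phi) e).
Proof. exact: existsP. Qed.

(** The Duplicator's strategy, by induction on the formula. The level [s] and the
    quality [K0] depend on a bound [b] for the size of the position, since the size
    grows by an amount that depends on the levels needed afterwards. *)
Lemma sat_invariant m (phi : fo_formula d.+1 m) : forall b, exists s K0,
  forall K, K0 <= K -> forall (T T' : finType) (H : {set {set T}})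
    (H' : {set {set T'}}), good_model H K -> good_model H' K ->
  forall (V : finType) S (W : {set V}) (f : V -> T) (f' : V -> T'),
    #|V| <= b -> occurs_generically H s S W f -> occurs_generically H' s S W f' ->
  forall e : 'I_m -> V,
    fo_sat H phi (fun i => f (e i)) = fo_sat H' phi (fun i => f' (e i)).
Proof.
elim: m / phi => [m i j|m x|m phi IH|m phi IH1 psi IH2|m phi IH] b.
- exists 0, 0 => K _ T T' H H' _ _ V S W f f' _ [fI _] [fI' _] e /=.
  by rewrite (inj_eq fI) (inj_eq fI').
- exists 1, 0 => K _ T T' H H' [Hu _ _] [Hu' _ _] V S W f f' _ of1 of2 e /=.
  have img (T0 : finType) (g : V -> T0) :
      [set v in map (fun i => g (e i)) x] = g @: [set v in map e x].
    apply/setP => y; rewrite inE; apply/mapP/imsetP => [[i ix ->]|[v + ->]].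
      by exists (e i); rewrite // inE map_f.
    by rewrite inE => /mapP[i ix ->]; exists i.
  by rewrite !img (occurs_generically_edge _ Hu of1) (occurs_generically_edge _ Hu' of2).
- have [s [K0 h]] := IH b; exists s, K0 => K K0K T T' H H' gH gH' V S W f f' cV o o' e.
  by rewrite /= (h K K0K T T' H H' gH gH' V S W f f' cV o o').
- have [s1 [K1 h1]] := IH1 b; have [s2 [K2 h2]] := IH2 b.
  exists (s1 + s2), (K1 + K2) => K K0K T T' H H' gH gH' V S W f f' cV o o' e /=.
  rewrite (h1 K _ T T' H H' gH gH' V S W f f') ?(h2 K _ T T' H H' gH gH' V S W f f') //.
  + exact: leq_trans (leq_addl _ _) K0K.
  + exact: occurs_generically_mono (leq_addl _ _) o.
  + exact: occurs_generically_mono (leq_addl _ _) o'.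
  + exact: leq_trans (leq_addr _ _) K0K.
  + exact: occurs_generically_mono (leq_addr _ _) o.
  + exact: occurs_generically_mono (leq_addr _ _) o'.
have [s1 hs] := choice IH; have [K1 hK] := choice hs => {IH hs}.
(* [lvl] is the level needed after a hull of size [c] has been added; [r] separates
   near moves from far ones, so that a hull of a far vertex stays far *)
pose lvl c := s1 (b + c); pose hsz := hull_size d lvl.
pose L := \sum_(j < M.+1) lvl (hsz j); pose r := hsz M.+1 + L.
pose s2 := s1 (b + d * r) + 2 ^ (b + d * r).
pose KK := \sum_(j < M.+1) K1 (b + hsz j).
exists (r + s2 + L), (b.+1 + hsz M.+1 + L.*2 + K1 (b + d * r) + KK).
move=> K K0K.
have lvlL j : j <= M -> lvl (hsz j) <= L.
  by rewrite -ltnS => jM; rewrite /L (bigD1 (Ordinal jM)) //= leq_addr.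
have KKj j : j <= M -> K1 (b + hsz j) <= K.
  rewrite -ltnS => jM; have : K1 (b + hsz j) <= KK.
    by rewrite /KK (bigD1 (Ordinal jM)) //= leq_addr.
  by move: K0K; clear; lia.
have hszr j : j <= M -> hsz j <= hsz M.+1.
  by move=> jM; apply: hull_size_homo; exact: leqW.
have [bK [hK' [LK K1K]]] :
    [/\ b < K & hsz M.+1 <= K /\ L.*2 <= K /\ K1 (b + d * r) <= K].
  by move: K0K; clear; lia.
clear K0K.
suff half (T T' : finType) (H : {set {set T}}) (H' : {set {set T'}}) :
    good_model H K -> good_model H' K ->
    forall (V : finType) S (W : {set V}) (f : V -> T) (f' : V -> T'),
    #|V| <= b -> occurs_generically H (r + s2 + L) S W f ->
    occurs_generically H' (r + s2 + L) S W f' ->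
    forall e : 'I_m -> V,
    fo_sat H (fo_ex phi) (fun i => f (e i)) ->
    fo_sat H' (fo_ex phi) (fun i => f' (e i)).
  move=> T T' H H' gH gH' V S W f f' cV o o' e.
  by apply/idP/idP; [apply: half cV o o' e|apply: half cV o' o e].
move=> gH gH' V S W f f' cV o o' e /sat_exP[x xsat].
have [Hu sp _] := gH; have [Hu' _ sat'] := gH'.
(* near move: follow the path to [x] *)
have [[y yx]|far_x] := pselect (exists y, reach H r (f y) x).
  have [|||V' [j [S' [W' [g [g' [x' [cV' og og' gf gx]]]]]]]] :=
      @reach_extension d r s2 T T' H H' Hu Hu' V S W f f' y x _ _ _ yx.
  - apply: leq_trans (leq_addl _ _); rewrite leq_exp2l //.
    by rewrite leq_add2r.
  - exact: occurs_generically_mono (leq_addr _ _) o.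
  - exact: occurs_generically_mono (leq_addr _ _) o'.
  apply/sat_exP; exists (g' x'); move: xsat; rewrite -gx.
  have -> : (fun i => f (e i)) = (fun i => g (j (e i))).
    by apply: functional_extensionality_dep => i; have [-> _] := gf (e i).
  have -> : (fun i => f' (e i)) = (fun i => g' (j (e i))).
    by apply: functional_extensionality_dep => i; have [_ ->] := gf (e i).
  rewrite -(env_cons_comp g x' (fun i => j (e i))).
  rewrite -(env_cons_comp g' x' (fun i => j (e i))).
  rewrite (hK (b + d * r) K K1K T T' H H' gH gH' V' S' W' g g') //.
  + by apply: leq_trans cV' _; rewrite leq_add2r.
  + exact: occurs_generically_mono (leq_addr _ _) og.
  + exact: occurs_generically_mono (leq_addr _ _) og'.
(* far move: enclose [x] in a generic hull and find a far copy of it in [H'] *)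
have [j [U [F [W0 [jM xU cU gU nU]]]]] := hull_exists Hu x excess_dense sp hK'.
rewrite -/hsz in cU gU nU; set c := hsz j in cU gU nU.
have [h [hI hU]] := enumerate U.
have [cf _ _] := gU.
have [S0 [W1 [hS hW]]] := config_pullback hU cf.
have oh : occurs_generically H (lvl c) S0 W1 h by split=> //; rewrite hU hS hW.
have cK : c <= K by apply: leq_trans (hszr j jM) hK'.
have [|||Phi oPhi] := sat' #|U| S0 W1.
- exact: leq_trans cU cK.
- move=> X XS; rewrite -(card_imset _ hI); apply: Hu.
  by have [FH _ _ _] := cf; apply: (fintype.subsetP FH); rewrite -hS mem_edge_image.
- apply: (admissible_copies dense_or_rich rich_add Hu sp _ (occurs_genericallyW oh)).
  by rewrite card_ord; exact: leq_trans cU cK.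
have oi := occurs_generically_copy oPhi.
have lK : (lvl c).*2 <= K by apply: leq_trans LK; rewrite leq_double; exact: lvlL.
have [|i fari] := @far_copy T' _ H' K (lvl c) (f' @: [set: V]) Phi _ lK
    (fun i => (oi i).2).
  by apply: leq_ltn_trans bK; apply: leq_trans (leq_imset_card _ _) _; rewrite cardsT.
have lK' : lvl c <= K by apply: leq_trans lK; rewrite -addnn leq_addr.
have ls : lvl c <= r + s2 + L by apply: leq_trans (leq_addl _ _); exact: lvlL.
have ou' := occurs_generically_union (occurs_generically_mono ls o')
  (occurs_generically_mono lK' (oi i).1) fari.
have ou : occurs_generically H (lvl c) (edge_image inl S :|: edge_image inr S0)
    (inl @: W :|: inr @: W1) (sum_map f h).
  apply: occurs_generically_union => //; first exact: occurs_generically_mono o.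
  move=> _ u /imsetP[y _ ->]; rewrite hU => uU yu; apply: far_x; exists y.
  apply: reach_mono (reach_trans yu (reach_sym (nU u uU))).
  by rewrite addnC /r leq_add // ?hszr // lvlL.
have /imsetP[i0 _ xi0] : x \in h @: [set: 'I_#|U|] by rewrite hU.
apply/sat_exP; exists (Phi (i, i0)); move: xsat.
have -> : x = sum_map f h (inr i0) by rewrite xi0.
have -> : Phi (i, i0) = sum_map f' (fun v => Phi (i, v)) (inr i0) by [].
rewrite -(env_cons_comp (sum_map f h) (inr i0) (fun i => inl (e i))).
rewrite -(env_cons_comp (sum_map f' _) (inr i0) (fun i => inl (e i))).
rewrite (hK (b + c) K (KKj j jM) T T' H H' gH gH' _ _ _ _ _ _ ou ou') //.
by rewrite card_sum card_ord; apply: leq_add.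
Qed.

End Game.

(** * Moments of the number of occurrences *)

Section Probability.
Local Open Scope set_scope.
Local Open Scope ring_scope.
Variables (R : realType) (d n : nat) (q : R).
Hypothesis q01 : 0 <= q <= 1.

Local Notation E := (potential_edges d.+1 n).
Local Notation graph := {set {set 'I_n}}.
Local Notation weight := (hypergraph_weight d.+1 q).

Definition expect (X : graph -> R) : R :=
  \sum_(H in powerset E) weight H * X H.

Lemma weight_ge0 (H : graph) : 0 <= weight H.
Proof.
have /andP[q0 q1] := q01.
by apply: prodr_ge0 => e _; case: ifP => // _; rewrite subr_ge0.
Qed.

Lemma probE (A : pred graph) :
  hypergraph_prob d.+1 q A = expect (fun H => (A H)%:R).
Proof.
rewrite /hypergraph_prob /expect big_mkcondr /=; apply: eq_bigr => H _.
by case: (A H); rewrite ?mulr1 ?mulr0.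
Qed.

Lemma expect1 : expect (fun=> 1) = 1.
Proof.
have h := @hypergraph_prob_indep R d.+1 n q finset.set0 finset.set0.
transitivity (hypergraph_prob d.+1 q (fun H : graph => H :&: finset.set0 == finset.set0)).
  by rewrite probE; apply: eq_bigr => H _; rewrite finset.setI0 eqxx.
by rewrite h ?finset.sub0set // finset.setD0 cards0 !expr0 mulr1.
Qed.

Lemma expectD X Y : expect (fun H => X H + Y H) = expect X + expect Y.
Proof. by rewrite -big_split; apply: eq_bigr => H _; rewrite mulrDr. Qed.

Lemma expectZ a X : expect (fun H => a * X H) = a * expect X.
Proof. by rewrite mulr_sumr; apply: eq_bigr => H _; rewrite mulrCA. Qed.

Lemma expect_sum (I : finType) (P : pred I) (X : I -> graph -> R) :
  expect (fun H => \sum_(i | P i) X i H) = \sum_(i | P i) expect (X i).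
Proof. by rewrite exchange_big; apply: eq_bigr => H _; rewrite mulr_sumr. Qed.

Lemma expect_le X Y :
  (forall H : graph, H \subset E -> X H <= Y H) -> expect X <= expect Y.
Proof.
move=> XY; apply: ler_sum => H; rewrite powersetE => /XY.
by apply: ler_wpM2l; exact: weight_ge0.
Qed.

Lemma expect_ge0 X : (forall H : graph, H \subset E -> 0 <= X H) -> 0 <= expect X.
Proof.
move=> X0; apply: sumr_ge0 => H; rewrite powersetE => /X0; apply: mulr_ge0.
exact: weight_ge0.
Qed.

Lemma prob_le (A B : pred graph) :
    (forall H : graph, H \subset E -> A H -> B H) ->
  hypergraph_prob d.+1 q A <= hypergraph_prob d.+1 q B.
Proof.
move=> AB; rewrite !probE; apply: expect_le => H /AB.
by case: (A H) => /=; [move=> ->|rewrite ler0n].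
Qed.

Lemma prob_ge0 (A : pred graph) : 0 <= hypergraph_prob d.+1 q A.
Proof. by rewrite probE; apply: expect_ge0 => H _; rewrite ler0n. Qed.

Lemma probC (A : pred graph) :
  hypergraph_prob d.+1 q (fun H => ~~ A H) = 1 - hypergraph_prob d.+1 q A.
Proof.
apply/eqP; rewrite eq_sym subr_eq; apply/eqP; rewrite !probE -expectD -[LHS]expect1.
by apply: eq_bigr => H _; case: (A H); rewrite ?add0r ?addr0.
Qed.

Lemma prob_union (I : finType) (A : I -> pred graph) :
  hypergraph_prob d.+1 q (fun H => [exists i, A i H]) <=
    \sum_i hypergraph_prob d.+1 q (A i).
Proof.
rewrite probE (eq_bigr _ (fun i _ => probE (A i))) -expect_sum.
apply: expect_le => H _; case: existsP => [[i AiH]|_] /=; last first.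
  by apply: sumr_ge0 => i _; rewrite ler0n.
by rewrite (bigD1 i) //= AiH lerDl; apply: sumr_ge0 => j _; rewrite ler0n.
Qed.

Definition touching (X : {set 'I_n}) : graph := [set e in E | ~~ [disjoint e & X]].

(** The exact number, through the edges contained in the complement of [X],
    depends on the size of [X] only. *)
Lemma card_touching X : #|touching X| = ('C(n, d.+1) - 'C(n - #|X|, d.+1))%N.
Proof.
have cE : #|E| = 'C(n, d.+1) by rewrite /potential_edges card_draws card_ord.
have <- : #|E :\: touching X| = 'C(n - #|X|, d.+1).
  rewrite -(_ : #|~: X| = (n - #|X|)%N); last first.
    by have := cardsC X; rewrite card_ord; lia.
  rewrite -cards_draws; apply: eq_card => e; rewrite !inE.
  rewrite finset.disjoints_subset negb_and negbK.
  by case: (#|e| == d.+1); rewrite ?andbT ?andbF ?orbF.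
rewrite -cE -(cardsID (touching X) E) addnK.
by apply: eq_card => e; rewrite !inE; case: eqP.
Qed.

Lemma edge_image_potential (V : finType) (S : {set {set V}}) (f : V -> 'I_n) :
  injective f -> uniform d S -> edge_image f S \subset E.
Proof.
move=> fI Su; apply/fintype.subsetP => _ /imsetP[e eS ->].
by rewrite inE card_imset // Su.
Qed.

(** For given [f], occurrence prescribes the presence of the edges in the image
    of [S], and the absence of all other edges at the images of the vertices of
    [W]. *)
Lemma occursE (V : finType) (S : {set {set V}}) (W : {set V}) (f : V -> 'I_n)
    (H : graph) : injective f -> uniform d S -> H \subset E ->
  `[< occurs H S W f >] =
    (H :&: (edge_image f S :|: touching (f @: W)) == edge_image f S).
Proof.
move=> fI Su HE; apply/asboolP/eqP => [[_ [SH _ _ WS]]|HS].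
  apply/setP => e; rewrite !inE; have [eS|eS] /= := boolP (e \in edge_image f S).
    by rewrite (fintype.subsetP SH).
  apply/negP => /andP[eH /andP[_ /pred0Pn[x /andP[xe xW]]]].
  by rewrite (WS x e) in eS.
split=> //; split.
- by rewrite -HS; exact: finset.subsetIl.
- by move=> _ /imsetP[e _ ->]; apply: imsetS; exact: finset.subsetT.
- by apply: imsetS; exact: finset.subsetT.
- move=> w e wW eH we; rewrite -HS !inE eH /= orbC.
  have := fintype.subsetP HE _ eH; rewrite inE => -> /=.
  by apply/orP; left; apply/pred0Pn; exists w; rewrite /= we wW.
Qed.

Lemma prob_occurs (V : finType) (S : {set {set V}}) (W : {set V}) (f : V -> 'I_n) :
    injective f -> uniform d S ->
  hypergraph_prob d.+1 q (fun H => `[< occurs H S W f >]) =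
    q ^+ #|S| * (1 - q) ^+ #|touching (f @: W) :\: edge_image f S|.
Proof.
move=> fI Su; set D := edge_image f S :|: touching (f @: W).
have -> : touching (f @: W) :\: edge_image f S = D :\: edge_image f S.
  by apply/setP => e; rewrite !inE; case: (e \in edge_image f S).
rewrite -(card_edge_image S fI) -(@hypergraph_prob_indep R d.+1).
- rewrite !probE; apply: eq_bigr => H; rewrite powersetE => HE.
  by rewrite occursE.
- exact: finset.subsetUl.
- rewrite finset.subUset edge_image_potential //=.
  by apply/fintype.subsetP => e; rewrite inE => /andP[].
Qed.

Definition touch_count m : nat := 'C(n, d.+1) - 'C(n - m, d.+1).

Lemma prob_occurs_ge (V : finType) (S : {set {set V}}) (W : {set V})
    (f : V -> 'I_n) : injective f -> uniform d S ->
  q ^+ #|S| * (1 - q) ^+ touch_count #|W| <=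
  hypergraph_prob d.+1 q (fun H => `[< occurs H S W f >]).
Proof.
move=> fI Su; rewrite prob_occurs //; have /andP[q0 q1] := q01.
apply: ler_wpM2l; first exact: exprn_ge0.
rewrite ler_wiXn2l ?subr_ge0 ?lerBlDr ?lerDl //.
apply: leq_trans (subset_leq_card (finset.subsetDl _ _)) _.
by rewrite card_touching card_imset.
Qed.

Lemma prob_occurs_le (V : finType) (S : {set {set V}}) (W : {set V})
    (f : V -> 'I_n) : uniform d S -> q < 1 ->
  hypergraph_prob d.+1 q (fun H => `[< occurs H S W f >]) <=
  q ^+ #|S| * ((1 - q) ^+ touch_count #|W| / (1 - q) ^+ #|S|).
Proof.
move=> Su q1; have /andP[q0 _] := q01; have q1' : 0 < 1 - q by rewrite subr_gt0.
have [fI|nfI] := pselect (injective f); last first.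
  apply: (@le_trans _ _ 0).
    rewrite probE /expect big1 // => H _; rewrite (_ : `[< _ >] = false) ?mulr0 //.
    by apply/asboolP => -[].
  by rewrite mulr_ge0 ?exprn_ge0 // divr_ge0 // exprn_ge0 // ltW.
rewrite prob_occurs //; apply: ler_wpM2l; first exact: exprn_ge0.
rewrite ler_pdivlMr ?exprn_gt0 // -exprD.
apply: ler_wiXn2l; rewrite ?(ltW q1') ?lerBlDr ?lerDl //.
have cW : #|f @: W| = #|W| by rewrite card_imset.
rewrite /touch_count -cW -card_touching -(card_edge_image S fI).
rewrite -(cardsID (edge_image f S) (touching _)) addnC leq_add2l.
exact: subset_leq_card (finset.subsetIr _ _).
Qed.

Definition occurrence_count (V : finType) (S : {set {set V}}) (W : {set V}) (H : graph) : R :=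
  \sum_(f : {ffun V -> 'I_n}) (`[< occurs H S W f >])%:R.

Lemma expect_count (V : finType) (S : {set {set V}}) (W : {set V}) :
  expect (occurrence_count S W) = \sum_(f : {ffun V -> 'I_n})
    hypergraph_prob d.+1 q (fun H => `[< occurs H S W f >]).
Proof. by rewrite expect_sum; apply: eq_bigr => f _; rewrite probE. Qed.

Lemma expect_count_ge (V : finType) (S : {set {set V}}) (W : {set V}) :
  uniform d S ->
  (n ^_ #|V|)%:R * (q ^+ #|S| * (1 - q) ^+ touch_count #|W|) <=
  expect (occurrence_count S W).
Proof.
move=> Su; have := card_inj_ffuns V 'I_n; rewrite card_ord => <-.
rewrite expect_count (bigID (fun f : {ffun V -> 'I_n} => injectiveb f)) /=.
rewrite mulr_natl -sumr_const -[X in X <= _]addr0; apply: lerD; last first.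
  by apply: sumr_ge0 => f _; exact: prob_ge0.
rewrite [X in X <= _](eq_bigl (fun f : {ffun V -> 'I_n} => injectiveb f)) => [|f]; last by rewrite inE.
by apply: ler_sum => f /injectiveP fI; rewrite prob_occurs_ge.
Qed.

Lemma expect_count_le (V : finType) (S : {set {set V}}) (W : {set V}) :
  uniform d S -> q < 1 ->
  expect (occurrence_count S W) <= n%:R ^+ #|V| *
    (q ^+ #|S| * ((1 - q) ^+ touch_count #|W| / (1 - q) ^+ #|S|)).
Proof.
move=> Su q1; rewrite expect_count.
apply: (@le_trans _ _ (\sum_(f : {ffun V -> 'I_n})
    q ^+ #|S| * ((1 - q) ^+ touch_count #|W| / (1 - q) ^+ #|S|))).
  by apply: ler_sum => f _; exact: prob_occurs_le.
by rewrite sumr_const card_ffun card_ord -[X in X <= _]mulr_natl natrX.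
Qed.

End Probability.

(** * Pairs of occurrences and defective occurrences *)

Section PairCount.
Local Open Scope set_scope.
Local Open Scope ring_scope.
Variables (R : realType) (d n : nat).
Variables (V : finType) (S : {set {set V}}) (W : {set V}).
Hypothesis Su : uniform d S.

Local Notation graph := {set {set 'I_n}}.
Local Notation count_occ := (@occurrence_count R n).

Lemma sum_fibers (I J : finType) (h : J -> I) (c : J -> R) :
  \sum_i \sum_j c j * (h j == i)%:R = \sum_j c j.
Proof.
rewrite exchange_big; apply: eq_bigr => j _.
rewrite (bigD1 (h j)) //= eqxx mulr1 big1 ?addr0 // => i.
by rewrite eq_sym => /negbTE->; rewrite mulr0.
Qed.

Lemma finfun_eq (A B : finType) (f : {ffun A -> B}) (g : A -> B) :
  (forall x, g x = f x) -> [ffun x => g x] = f.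
Proof. by move=> gf; apply/ffunP => x; rewrite ffunE gf. Qed.

(** The numerical relation to [(S, W)] of a pattern with [k] more vertices that
    witnesses the failure of genericity of an occurrence of [(S, W)]. *)
Definition improvement k (P : {set {set V + 'I_k}} * {set V + 'I_k}) : bool :=
  `[< [/\ uniform d P.1, (#|S| <= #|P.1|)%N, (#|W| <= #|P.2|)%N,
      (k <= d * (#|P.1| - #|S|))%N
      & (k + #|W| < d * (#|P.1| - #|S|) + #|P.2|)%N] >].

Definition count_bad s (H : graph) : R :=
  \sum_(f : {ffun V -> 'I_n})
    (`[< occurs H S W f /\ ~ occurs_generically H s S W f >])%:R.

(** A defective occurrence of [(S, W)] extends to an occurrence of one of finitely
    many larger patterns, from which it is recovered by restriction. *)
Lemma count_bad_le s (H : graph) : uniform d H ->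
  count_bad s H <= \sum_(k < (d * s.*2.+1).+1)
    \sum_(P | @improvement k P) count_occ P.1 P.2 H.
Proof.
have arith1 a b c e : (a + b <= c + e -> c <= a -> b <= e -> a - c <= e - b)%N by lia.
have arith2 a b c e m m' : (a + b + m < c + e + m' -> c <= a -> b <= e ->
  a - c + m < e - b + m')%N by lia.
move=> Hu; pose restr k (f : {ffun V + 'I_k -> 'I_n}) := [ffun v => f (inl v)].
have -> : \sum_(k < (d * s.*2.+1).+1)
    \sum_(P | @improvement k P) count_occ P.1 P.2 H =
  \sum_(f : {ffun V -> 'I_n}) \sum_(k < (d * s.*2.+1).+1)
    \sum_(P | @improvement k P) \sum_(g : {ffun V + 'I_k -> 'I_n})
      (`[< occurs H P.1 P.2 g >])%:R * (restr k g == f)%:R.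
  rewrite [RHS]exchange_big; apply: eq_bigr => k _; rewrite [RHS]exchange_big /=.
  by apply: eq_bigr => P _; rewrite sum_fibers.
apply: ler_sum => f _; case: asboolP => [[[fI cf] ng]|_]; last first.
  by apply: sumr_ge0 => k _; apply: sumr_ge0 => P _; apply: sumr_ge0 => g _;
     rewrite mulr_ge0 ?ler0n.
have [U' [F' [W' [cf' [gr' lt']]]]] :
    exists U' F' W', config H U' F' W' /\
      improves d H s.*2.+1 (f @: [set: V]) (edge_image f S) (f @: W) U' F' W'.
  apply: (not_generic_improves Hu cf).
  by move=> ge; apply: ng; split.
have [[sU sF sW] b c _] := gr'.
have cU : #|f @: [set: V]| = #|V| by rewrite card_imset // cardsT.
have cF : #|edge_image f S| = #|S| by rewrite card_edge_image.
have cW : #|f @: W| = #|W| by rewrite card_imset.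
have leU := subset_leq_card sU; have leF := subset_leq_card sF.
have leW := subset_leq_card sW.
rewrite cU cF cW in b c lt' leU leF leW.
pose k := (#|U'| - #|V|)%N.
have [|g [gI gU]] := extend_injection fI sU (_ : _ = #|V| + k)%N.
  by rewrite /k subnKC.
have [S' [W1 [hS hW]]] := config_pullback gU cf'.
have kB : (k < (d * s.*2.+1).+1)%N by rewrite ltnS /k leq_subLR.
rewrite (bigD1 (Ordinal kB)) //= (bigD1 (S', W1)) /=; last first.
  apply/asboolP; have cS' : #|S'| = #|F'| by rewrite -hS card_edge_image.
  have cW' : #|W1| = #|W'| by rewrite -hW card_imset.
  rewrite /= cS' cW' /k; split=> //.
  - move=> e eS; rewrite -(card_imset _ gI); apply: Hu.
    have [FH _ _ _] := cf'; apply: (fintype.subsetP FH).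
    by rewrite -hS mem_edge_image.
  - by rewrite mulnBr; exact: arith1 b leU (leq_mul (leqnn d) leF).
  - by rewrite mulnBr; exact: arith2 lt' leU (leq_mul (leqnn d) leF).
have gE : sum_map f g =1 finfun (sum_map f g) by move=> x; rewrite ffunE.
rewrite (bigD1 (finfun (sum_map f g))) //= -!addrA.
have -> : restr k (finfun (sum_map f g)) == f.
  by apply/eqP/ffunP => v; rewrite !ffunE.
have -> : `[< occurs H S' W1 (finfun (sum_map f g)) >].
  apply/asboolP; split; first exact: eq_inj gI gE.
  rewrite -(eq_edge_image S' gE) hS -(eq_imset _ gE) gU.
  by rewrite -(eq_imset W1 gE) hW.
rewrite mulr1 lerDl; apply: addr_ge0.
  by apply: sumr_ge0 => h _; rewrite mulr_ge0 ?ler0n.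
by apply: addr_ge0; [apply: sumr_ge0 => P _|apply: sumr_ge0 => k' _; apply: sumr_ge0 => P _];
  apply: sumr_ge0 => h _; rewrite mulr_ge0 ?ler0n.
Qed.

Section Merge.
Variables (j : nat) (g : {ffun V -> V + 'I_j}).

Definition overlap : {set V} := [set u | g u \in inl @: [set: V]].
Definition overlap_edges : {set {set V}} := [set e in S | g @: e \in edge_image inl S].
Definition overlap_marks : {set V} := [set w in W | g w \in inl @: W].
Definition merge_edges : {set {set V + 'I_j}} := edge_image inl S :|: edge_image g S.
Definition merge_marks : {set V + 'I_j} := inl @: W :|: g @: W.
(** Here [g] records how the second of two intersecting occurrences sits in the
    union of both, the first one being [inl]. The intersection, read on the second
    one, is a sub-pattern of [(S, W)]. *)
Definition mergeable : bool :=
  `[< [/\ injective g, (#|overlap| + j = #|V|)%N, overlap != finset.set0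
        & config S overlap overlap_edges overlap_marks] >].

Lemma inl_inj (A B : Type) : injective (@inl A B).
Proof. by move=> x y []. Qed.

Lemma card_merge_edges : injective g ->
  (#|merge_edges| + #|overlap_edges| = #|S| + #|S|)%N.
Proof.
move=> gI; rewrite -{1}(card_edge_image S (@inl_inj V 'I_j)) -(card_edge_image S gI).
rewrite -cardsUI; congr addn; rewrite -(card_edge_image overlap_edges gI).
apply: eq_card => e; rewrite !inE; apply/imsetP/andP => [[e']|[eS /imsetP[e' e'S ee']]].
  by rewrite inE => /andP[e'S ge] ->; rewrite ge mem_edge_image.
by exists e'; rewrite // inE e'S -ee'.
Qed.

Lemma card_merge_marks : injective g ->
  (#|merge_marks| + #|overlap_marks| = #|W| + #|W|)%N.
Proof.
move=> gI; rewrite -{1}(card_imset W (@inl_inj V 'I_j)) -(card_imset W gI).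
rewrite -cardsUI; congr addn; rewrite -(card_imset overlap_marks gI).
apply: eq_card => x; rewrite !inE; apply/imsetP/andP => [[w]|[xW /imsetP[w wW xw]]].
  by rewrite inE => /andP[wW gw] ->; rewrite gw imset_f.
by exists w; rewrite // inE wW -xw.
Qed.

Lemma merge_uniform : injective g -> uniform d merge_edges.
Proof.
move=> gI e; rewrite inE => /orP[|] /imsetP[e' /Su e'S ->]; rewrite card_imset //.
exact: inl_inj.
Qed.

End Merge.

Definition double_edges : {set {set V + V}} := edge_image inl S :|: edge_image inr S.
Definition double_marks : {set V + V} := inl @: W :|: inr @: W.

(** Two intersecting occurrences amount to one occurrence of the pattern of their
    union. A vertex complete in both carries in [H] only edges of both, which makes
    the intersection a sub-pattern in the sense of [admissible]. *)
Lemma occurs_merge (H : graph) (f f' : {ffun V -> 'I_n}) :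
    occurs H S W f -> occurs H S W f' ->
    ~~ [disjoint f @: [set: V] & f' @: [set: V]] ->
  exists j (g : {ffun V -> V + 'I_j}) (h : {ffun V + 'I_j -> 'I_n}),
    [/\ (j < #|V|.+1)%N, mergeable g, occurs H (merge_edges g) (merge_marks g) h,
        (forall v, h (inl v) = f v) & (forall v, h (g v) = f' v)].
Proof.
move=> [fI cf] [f'I cf'] ndis.
set A := f @: [set: V]; set B := f' @: [set: V].
have cA : #|A| = #|V| by rewrite card_imset // cardsT.
have cB : #|B| = #|V| by rewrite card_imset // cardsT.
pose j := #|B :\: A|.
have [||h [hI hU]] := @extend_injection V 'I_n f (A :|: B) j fI.
- exact: finset.subsetUl.
- by rewrite -cA /j cardsU cardsD (finset.setIC B) addnBA // subset_leq_card //
       finset.subsetIr.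
set chi := sum_map f h in hI hU.
have pre v : exists x, chi x = f' v.
  have : f' v \in A :|: B by rewrite inE imset_f ?orbT.
  by rewrite -hU => /imsetP[x _ ->]; exists x.
have [g0 g0E] := choice pre; pose g := finfun g0.
have gE v : chi (g v) = f' v by rewrite ffunE.
have gI : injective g.
  by move=> v w gvw; apply: f'I; rewrite -!gE gvw.
have imE (e : {set V}) : chi @: (g @: e) = f' @: e.
  by rewrite -imset_comp; apply: eq_imset => v /=; rewrite gE.
have imL (e : {set V}) : chi @: (inl @: e) = f @: e.
  by rewrite -imset_comp; apply: eq_imset.
have imgE : edge_image chi (edge_image g S) = edge_image f' S.
  by rewrite edge_image_comp; apply: eq_edge_image => v /=; rewrite gE.
have imgL : edge_image chi (edge_image inl S) = edge_image f S.
  by rewrite edge_image_comp; apply: eq_edge_image.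
have ovE v : (v \in overlap g) = (f' v \in A).
  by rewrite inE -(mem_imset _ _ hI) gE imL.
have cov : #|overlap g| = #|B :&: A|.
  rewrite -(card_imset _ f'I); apply: eq_card => x; rewrite !inE.
  apply/imsetP/andP => [[v]|[/imsetP[v _ ->] vA]].
    by rewrite ovE => vA ->; split=> //; apply: imset_f.
  by exists v; rewrite // ovE.
have chiE : chi =1 finfun chi by move=> x; rewrite ffunE.
exists j, g, (finfun chi); split.
- by rewrite ltnS -cB; apply: subset_leq_card; exact: finset.subsetDl.
- apply/asboolP; split=> //.
  + by rewrite cov /j -cB cardsID.
  + rewrite -finset.card_gt0 cov card_gt0; apply: contra ndis => /eqP BA.
    by rewrite -setI_eq0 finset.setIC BA.
  + split.
    * by apply/fintype.subsetP => e; rewrite inE => /andP[].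
    * move=> e; rewrite inE => /andP[_ /imsetP[e0 _ ge]].
      apply/fintype.subsetP => v ve; rewrite inE.
      have : g v \in inl @: e0 by rewrite -ge imset_f.
      by apply: (fintype.subsetP (imsetS _ (finset.subsetT _))).
    * apply/fintype.subsetP => w; rewrite !inE => /andP[_].
      by apply: (fintype.subsetP (imsetS _ (finset.subsetT _))).
    * move=> w e; rewrite inE => /andP[wW gw] eS we; rewrite inE eS /=.
      rewrite -(mem_edge_image _ _ hI) imE imgL.
      have [_ _ _ WF] := cf; apply: (WF (f' w)).
      - by rewrite -gE -imL imset_f.
      - have [FH' _ _ _] := cf'; apply: (fintype.subsetP FH').
        by rewrite mem_edge_image.
      - exact: imset_f.
- split; first exact: eq_inj hI chiE.
  rewrite -(eq_edge_image _ chiE) -!(eq_imset _ chiE) hU edge_imageU imgE imgL.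
  by rewrite imsetU imE imL; apply: config_union.
- by move=> v; rewrite ffunE.
- by move=> v; rewrite ffunE gE.
Qed.

(** The square counts pairs of occurrences, disjoint or intersecting. *)
Lemma count_sqr_le (H : graph) :
  count_occ S W H ^+ 2 <= count_occ double_edges double_marks H +
    \sum_(j < #|V|.+1) \sum_(g : {ffun V -> V + 'I_j} | mergeable g)
       count_occ (merge_edges g) (merge_marks g) H.
Proof.
pose c (f : {ffun V -> 'I_n}) : R := (`[< occurs H S W f >])%:R.
pose restr2 (h : {ffun V + V -> 'I_n}) :=
  ([ffun v => h (inl v)], [ffun v => h (inr v)]).
pose restr j (g : {ffun V -> V + 'I_j}) (h : {ffun V + 'I_j -> 'I_n}) :=
  ([ffun v => h (inl v)], [ffun v => h (g v)]).
have -> : count_occ S W H ^+ 2 =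
    \sum_(ff : {ffun V -> 'I_n} * {ffun V -> 'I_n}) c ff.1 * c ff.2.
  by rewrite expr2 /occurrence_count big_distrlr /= pair_bigA.
have -> : count_occ double_edges double_marks H =
    \sum_(ff : {ffun V -> 'I_n} * {ffun V -> 'I_n}) \sum_(h : {ffun V + V -> 'I_n})
      (`[< occurs H double_edges double_marks h >])%:R * (restr2 h == ff)%:R.
  by rewrite sum_fibers.
have -> : \sum_(j < #|V|.+1) \sum_(g : {ffun V -> V + 'I_j} | mergeable g)
       count_occ (merge_edges g) (merge_marks g) H =
   \sum_(ff : {ffun V -> 'I_n} * {ffun V -> 'I_n})
    \sum_(j < #|V|.+1) \sum_(g : {ffun V -> V + 'I_j} | mergeable g)
      \sum_(h : {ffun V + 'I_j -> 'I_n})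
      (`[< occurs H (merge_edges g) (merge_marks g) h >])%:R * (restr j g h == ff)%:R.
  rewrite [RHS]exchange_big; apply: eq_bigr => j _; rewrite [RHS]exchange_big /=.
  by apply: eq_bigr => g _; rewrite sum_fibers.
rewrite -big_split /=; apply: ler_sum => -[f f'] _ /=.
have ge2 : 0 <= \sum_(j < #|V|.+1) \sum_(g : {ffun V -> V + 'I_j} | mergeable g)
    \sum_(h : {ffun V + 'I_j -> 'I_n}) (`[< occurs H (merge_edges g) (merge_marks g) h >])%:R *
      (restr j g h == (f, f'))%:R :> R.
  by do 3 (apply: sumr_ge0 => ? _); rewrite mulr_ge0 ?ler0n.
have ge1 : 0 <= \sum_(h : {ffun V + V -> 'I_n})
      (`[< occurs H double_edges double_marks h >])%:R * (restr2 h == (f, f'))%:R :> R.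
  by apply: sumr_ge0 => ? _; rewrite mulr_ge0 ?ler0n.
rewrite /c; case: asboolP => [oc|_]; last by rewrite mul0r addr_ge0.
case: asboolP => [oc'|_]; last by rewrite mulr0 addr_ge0.
rewrite mulr1.
have [dis|ndis] := boolP [disjoint f @: [set: V] & f' @: [set: V]].
  rewrite -[X in X <= _]addr0; apply: lerD => //.
  rewrite (bigD1 (finfun (sum_map f f'))) //= -[X in X <= _]addr0.
  apply: lerD; last by apply: sumr_ge0 => ? _; rewrite mulr_ge0 ?ler0n.
  have -> : restr2 (finfun (sum_map f f')) == (f, f').
    by apply/eqP; congr pair; apply: finfun_eq => v; rewrite ffunE.
  have sE : sum_map f f' =1 finfun (sum_map f f') by move=> x; rewrite ffunE.
  rewrite mulr1 (_ : `[< _ >] = true) //; apply/asboolP.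
  have [fI cf] := oc; have [f'I cf'] := oc'; split.
    apply: eq_inj sE; apply: sum_map_inj => // v w fvw.
    have := disjointFr dis (imset_f f (finset.in_setT v)).
    by rewrite fvw imset_f.
  rewrite -(eq_edge_image _ sE) -!(eq_imset _ sE) sum_map_image edge_imageU imsetU.
  rewrite !edge_image_comp -!imset_comp; exact: config_union cf cf'.
have [j [g [h [jV mg och hf hf']]]] := occurs_merge oc oc' ndis.
rewrite -[X in X <= _]add0r; apply: lerD => //.
rewrite (bigD1 (Ordinal jV)) //= (bigD1 g) //= (bigD1 h) //= -!addrA.
have -> : restr j g h == (f, f').
  by apply/eqP; congr pair; apply: finfun_eq.
rewrite (_ : `[< _ >] = true); last exact/asboolP.
rewrite mulr1 lerDl; apply: addr_ge0.
  by apply: sumr_ge0 => ? _; rewrite mulr_ge0 ?ler0n.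
by apply: addr_ge0; do ?[apply: sumr_ge0 => ? _]; rewrite mulr_ge0 ?ler0n.
Qed.

Lemma card_double_edges : #|double_edges| = (#|S| + #|S|)%N.
Proof.
rewrite cardsU !card_edge_image; try by move=> x y [].
rewrite (_ : _ :&: _ = finset.set0) ?cards0 ?subn0 //; apply/setP => e.
rewrite !inE; apply/negP => /andP[/imsetP[e1 e1S ->] /imsetP[e2 e2S e12]].
have /card_gt0P[v ve] : (0 < #|e1|)%N by rewrite Su.
have : inl v \in [set (inr x : V + V) | x in e2] by rewrite -e12 imset_f.
by case/imsetP.
Qed.

Lemma card_double_marks : #|double_marks| = (#|W| + #|W|)%N.
Proof.
rewrite cardsU !card_imset; try by move=> x y [].
rewrite (_ : _ :&: _ = finset.set0) ?cards0 ?subn0 //; apply/setP => e.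
by rewrite !inE; apply/negP => /andP[/imsetP[e1 e1S ->] /imsetP[e2 e2S]].
Qed.

Lemma double_uniform : uniform d double_edges.
Proof.
by move=> e; rewrite inE => /orP[|] /imsetP[e' /Su e'S ->]; rewrite card_imset // => x y [].
Qed.

End PairCount.

(** * Limits of real sequences *)

Section Limits.
Local Open Scope classical_set_scope.
Local Open Scope ring_scope.
Variable R : realType.
Implicit Types (f g : nat -> R) (a b c k l : R).

Lemma lim_eq f g l : (\forall n \near \oo, f n = g n) -> f @ \oo --> l ->
  g @ \oo --> l.
Proof.
move=> fg fl; apply: (squeeze_cvgr _ fl fl).
by apply: filterS fg => n ->; rewrite lexx.
Qed.

Lemma lim_mul f g a b c : f @ \oo --> a -> g @ \oo --> b -> a * b = c ->
  (fun n => f n * g n) @ \oo --> c.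
Proof. by move=> fa gb <-; exact: cvgM. Qed.

Lemma lim_add f g a b c : f @ \oo --> a -> g @ \oo --> b -> a + b = c ->
  (fun n => f n + g n) @ \oo --> c.
Proof. by move=> fa gb <-; exact: cvgD. Qed.

Lemma lim_scale f a k c : f @ \oo --> a -> k * a = c ->
  (fun n => k * f n) @ \oo --> c.
Proof. by move=> fa kc; apply: lim_mul kc => //; exact: cvg_cst. Qed.

Lemma lim_exp f a (k : nat) : f @ \oo --> a -> (fun n => f n ^+ k) @ \oo --> a ^+ k.
Proof.
move=> fa; elim: k => [|k IH].
  by rewrite expr0; under eq_fun do rewrite expr0; exact: cvg_cst.
under eq_fun do rewrite exprS; exact: lim_mul fa IH (esym (exprS _ _)).
Qed.

Lemma lim_sum0 (I : finType) (P : pred I) (F : I -> nat -> R) :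
  (forall i, P i -> F i @ \oo --> (0 : R)) ->
  (fun n => \sum_(i | P i) F i n) @ \oo --> (0 : R).
Proof.
move=> F0; pose s := index_enum I; rewrite -/s.
elim: s => [|i s IH]; first by under eq_fun do rewrite big_nil; exact: cvg_cst.
case Pi: (P i); under eq_fun do rewrite big_cons Pi; last exact: IH.
by apply: lim_add (F0 i Pi) IH _; rewrite addr0.
Qed.

Lemma lim0_le f g : (\forall n \near \oo, 0 <= f n <= g n) ->
  g @ \oo --> (0 : R) -> f @ \oo --> (0 : R).
Proof. by move=> fg g0; apply: (squeeze_cvgr fg (cvg_cst _) g0). Qed.

Lemma lim_falling v : (fun n => (n ^_ v)%:R / n%:R ^+ v : R) @ \oo --> (1 : R).
Proof.
elim: v => [|v IH].
  by under eq_fun do rewrite ffactn0 expr0 divr1; exact: cvg_cst.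
have nv : (fun n => (n%:R : R)^-1) @ \oo --> (0 : R).
  by rewrite -(cvg_shiftS (fun n => (n%:R : R)^-1)); exact: cvg_harmonic.
have l1 : (fun n => 1 - v%:R * (n%:R : R)^-1) @ \oo --> (1 : R).
  apply: (@lim_add (fun=> 1) (fun n => - (v%:R * (n%:R)^-1)) 1 0).
  - exact: cvg_cst.
  - rewrite -oppr0; apply: cvgN; apply: lim_scale nv _; exact: mulr0.
  - by rewrite addr0.
apply: lim_eq (lim_mul IH l1 (mulr1 _)).
near=> n; have vn : (v < n)%N by near: n; exact: nbhs_infty_gt.
have n0 : (n%:R : R) != 0 by rewrite pnatr_eq0 -lt0n (leq_ltn_trans _ vn).
rewrite ffactnSr natrM (natrB _ (ltnW vn)) exprSr.
by field; rewrite n0 expf_neq0.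
Unshelve. all: by end_near. Qed.

End Limits.

(** * Properties that hold with high probability *)

Section HighProbability.
Local Open Scope classical_set_scope.
Local Open Scope set_scope.
Local Open Scope ring_scope.
Variables (R : realType) (d : nat) (p Q : nat -> R).
Hypothesis p01 : forall n, 0 <= p n <= 1.
Hypothesis p_gt0 : \forall n \near \oo, 0 < p n.
Hypothesis p_lim : p @ \oo --> (0 : R).
Hypothesis Q_gt0 : forall n, 0 < Q n.
Hypothesis touch_lim : forall m,
  (fun n => (1 - p n) ^+ touch_count d n m / Q n ^+ m) @ \oo --> (1 : R).

Definition mean_value v e m (n : nat) : R := n%:R ^+ v * p n ^+ e * Q n ^+ m.
Definition vanishing v e m : Prop := mean_value v e m @ \oo --> (0 : R).
(** Divergence of the mean to infinity, in the form in which it enters products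
    and upper bounds. *)
Definition abundant v e m : Prop := (fun n => (mean_value v e m n)^-1) @ \oo --> (0 : R).

Hypothesis drift : forall v e m : nat,
  (v < d * e)%N \/ (v <= d * e)%N /\ (0 < m)%N -> vanishing v e m.

Lemma mean_value_gt0 v e m : \forall n \near \oo, 0 < mean_value v e m n.
Proof.
near=> n; rewrite /mean_value; apply: mulr_gt0; last exact: exprn_gt0.
apply: mulr_gt0; apply: exprn_gt0; last by near: n.
by rewrite ltr0n; near: n; exact: nbhs_infty_gt.
Unshelve. all: by end_near. Qed.

Lemma mean_valueD v e m v' e' m' n :
  mean_value (v + v') (e + e') (m + m') n = mean_value v e m n * mean_value v' e' m' n.
Proof. by rewrite /mean_value !exprD; ring. Qed.

Lemma abundantD v e m v' e' m' : abundant v e m -> abundant v' e' m' ->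
  abundant (v + v') (e + e') (m + m').
Proof.
move=> a a'; rewrite /abundant.
under eq_fun do rewrite mean_valueD invfM.
by apply: lim_mul a a' _; rewrite mulr0.
Qed.

(** The factor by which the probability of an occurrence may exceed
    [p ^+ e * Q ^+ m]. The division by [(1 - p n) ^+ e] accounts for the edges of
    the pattern at complete vertices, which need not be absent. *)
Definition correction e m (n : nat) : R :=
  (1 - p n) ^+ touch_count d n m / Q n ^+ m / (1 - p n) ^+ e.

Lemma correction_lim e m : correction e m @ \oo --> (1 : R).
Proof.
apply: lim_mul (touch_lim m) _ (mulr1 _).
have l1 : (fun n => 1 - p n) @ \oo --> (1 : R).
  apply: (@lim_add R (fun=> 1) (fun n => - p n) 1 0); rewrite ?addr0 //.
    exact: cvg_cst.
  by rewrite -oppr0; exact: cvgN.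
have := lim_exp (k := e) l1; rewrite expr1n => l1e.
have := cvgV (oner_neq0 R) l1e; rewrite invr1; exact.
Qed.

Lemma p_lt1 : \forall n \near \oo, p n < 1.
Proof. exact: (cvgr_lt 0 p_lim _ ltr01). Qed.

Lemma expect_count_le_mean (V : finType) (S : {set {set V}}) (W : {set V}) :
  uniform d S -> \forall n \near \oo,
  expect d (p n) (@occurrence_count R n V S W) <=
    mean_value #|V| #|S| #|W| n * correction #|S| #|W| n.
Proof.
move=> Su; near=> n.
have p1 : p n < 1 by near: n; exact: p_lt1.
apply: le_trans (@expect_count_le R d n (p n) (p01 n) V S W Su p1) _.
rewrite le_eqVlt; apply/orP; left; apply/eqP.
rewrite /mean_value /correction; have := lt0r_neq0 (Q_gt0 n).
have : (1 - p n) != 0 by rewrite subr_eq0 eq_sym lt_eqF.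
move=> h1 h2; have alg (a b c x y : R) : x != 0 -> y != 0 ->
  a * (b * (c / y)) = a * b * x * (c / x / y) by move=> x0 y0; field; rewrite ?x0 ?y0.
by apply: alg; apply: expf_neq0.
Unshelve. all: by end_near. Qed.

Definition whp (A : forall n, {set {set 'I_n}} -> Prop) : Prop :=
  (fun n => hypergraph_prob d.+1 (p n) (fun H : {set {set 'I_n}} => `[< ~ A n H >]))
    @ \oo --> (0 : R).

Lemma whp_le (A B : forall n, {set {set 'I_n}} -> Prop) :
  (forall n (H : {set {set 'I_n}}), H \subset potential_edges d.+1 n -> A n H -> B n H) ->
  whp A -> whp B.
Proof.
move=> AB; apply: lim0_le; near=> n; rewrite prob_ge0 //=.
by apply: prob_le => // H HE /asboolP nB; apply/asboolP => /(AB _ _ HE).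
Unshelve. all: by end_near. Qed.

Lemma whp_forall (I : finType) (A : I -> forall n, {set {set 'I_n}} -> Prop) :
  (forall i, whp (A i)) -> whp (fun n H => forall i, A i n H).
Proof.
move=> wA; apply: lim0_le (lim_sum0 (P := predT) (fun i _ => wA i)).
near=> n; rewrite prob_ge0 //=; apply: (le_trans _ (@prob_union R d n (p n) (p01 n) I (fun i H => `[< ~ A i n H >]))).
apply: prob_le => // H HE /asboolP/existsNP[i nA].
by apply/existsP; exists i; apply/asboolP.
Unshelve. all: by end_near. Qed.

Lemma whp_impl (P : Prop) (A : forall n, {set {set 'I_n}} -> Prop) :
  (P -> whp A) -> whp (fun n H => P -> A n H).
Proof.
move=> PA; have [h|nP] := pselect P.
  by apply: whp_le (PA h) => n H _ a _.
apply: lim_eq (cvg_cst 0); near=> n; rewrite probE /expect big1 // => H _.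
by rewrite (_ : `[< _ >] = false) ?mulr0 //; apply/asboolP; apply.
Unshelve. all: by end_near. Qed.

Lemma whp_and (A B : forall n, {set {set 'I_n}} -> Prop) : whp A -> whp B -> whp (fun n H => A n H /\ B n H).
Proof.
move=> wA wB; have := @whp_forall bool (fun b => if b then A else B).
move=> /(_ (fun b => if b return whp (if b then A else B) then wA else wB)).
by apply: whp_le => n H _ h; split; [exact: (h true)|exact: (h false)].
Qed.

(** First moment method: the probability of an occurrence is at most the expected
    number of occurrences. *)
Lemma whp_not_occurs (V : finType) (S : {set {set V}}) (W : {set V}) :
    uniform d S -> vanishing #|V| #|S| #|W| ->
  whp (fun n H => forall f : V -> 'I_n, ~ occurs H S W f).
Proof.
move=> Su van.
apply: lim0_le (lim_mul van (correction_lim #|S| #|W|) (mul0r _)).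
near=> n; rewrite prob_ge0 //=.
apply: (@le_trans _ _ (expect d (p n) (@occurrence_count R n V S W))); last first.
  by near: n; exact: expect_count_le_mean.
rewrite probE; apply: expect_le => // H HE; case: asboolP => /=; last first.
  by move=> _; apply: sumr_ge0 => f _; rewrite ler0n.
move=> /existsNP[f /contrapT oc]; rewrite /occurrence_count (bigD1 (finfun f)) //=.
have fE : f =1 finfun f by move=> x; rewrite ffunE.
rewrite (_ : `[< _ >] = true) ?lerDl; first by apply: sumr_ge0 => g _; rewrite ler0n.
apply/asboolP; have [fI cf] := oc; split; first exact: eq_inj fE.
by rewrite -(eq_edge_image _ fE) -!(eq_imset _ fE).
Unshelve. all: by end_near. Qed.

Lemma uniformP n (H : {set {set 'I_n}}) :
  H \subset potential_edges d.+1 n <-> uniform d H.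
Proof.
split=> [/fintype.subsetP HE e /HE|Hu]; first by rewrite inE => /eqP.
by apply/fintype.subsetP => e eH; rewrite inE Hu.
Qed.

Lemma whp_sparse K : whp (fun n H => sparse H vanishing K).
Proof.
have : whp (fun n H => forall (v : 'I_K.+1)
   (SW : {set {set 'I_v}} * {set 'I_v}), uniform d SW.1 ->
   vanishing v #|SW.1| #|SW.2| -> forall f : 'I_v -> 'I_n, ~ occurs H SW.1 SW.2 f).
  apply: whp_forall => v; apply: whp_forall => SW.
  apply: whp_impl => Su; apply: whp_impl => van.
  by apply: whp_not_occurs => //; rewrite card_ord.
apply: whp_le => n H /uniformP Hu h U F W cf UK van.
have [f [fI fU]] := enumerate U; have [S [W' [fS fW]]] := config_pullback fU cf.
have cS : #|S| = #|F| by rewrite -fS card_edge_image.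
have cW : #|W'| = #|W| by rewrite -fW card_imset.
have UK' : (#|U| < K.+1)%N by rewrite ltnS.
apply: (h (Ordinal UK') (S, W') _ _ f) => /=.
- move=> e eS; rewrite -(card_imset _ fI); apply: Hu.
  by have [FH _ _ _] := cf; apply: (fintype.subsetP FH); rewrite -fS mem_edge_image.
- by rewrite cS cW.
- by split=> //; rewrite fU fS fW.
Qed.

Section SecondMoment.
Variables (V : finType) (S : {set {set V}}) (W : {set V}) (s : nat).
Hypothesis Su : uniform d S.
Hypothesis adm : admissible abundant S W.

Let val n := mean_value #|V| #|S| #|W| n.
Let X n := @occurrence_count R n V S W.
Let Y n := @count_bad R n V S W s.

Lemma mean_ratio_le k e m n : 0 < val n -> (#|S| <= e)%N -> (#|W| <= m)%N ->
  mean_value (#|V| + k) e m n / val n = mean_value k (e - #|S|) (m - #|W|) n.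
Proof.
move=> v0 Se Wm; rewrite -[in LHS](subnKC Se) -[in LHS](subnKC Wm) mean_valueD.
by rewrite mulrAC mulfV ?lt0r_neq0 // mul1r.
Qed.

(** Failing genericity costs at least one vertex for the number of edges added,
    or an additional complete vertex; the ratio of the means is then that of a
    vanishing shape. *)
Lemma expect_bad_lim : (fun n => expect d (p n) (@Y n) / val n) @ \oo --> (0 : R).
Proof.
pose term k (P : {set {set V + 'I_k}} * {set V + 'I_k}) n :=
  mean_value k (#|P.1| - #|S|) (#|P.2| - #|W|) n * correction #|P.1| #|P.2| n.
have lim0 : (fun n => \sum_(k < (d * s.*2.+1).+1)
    \sum_(P | @improvement d V S W k P) term k P n) @ \oo --> (0 : R).
  apply: lim_sum0 => k _; apply: lim_sum0 => P /asboolP[Pu Sle Wle kle klt].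
  apply: lim_mul (correction_lim _ _) (mul0r _); apply: drift.
  have [|ge] := ltnP k (d * (#|P.1| - #|S|)); first by left.
  right; split=> //; rewrite subn_gt0 -(ltn_add2l k).
  by apply: leq_trans klt _; rewrite leq_add2r.
apply: lim0_le lim0.
have le_near : \forall n \near \oo, forall (k : 'I_(d * s.*2.+1).+1)
    (P : {set {set V + 'I_k}} * {set V + 'I_k}), @improvement d V S W k P ->
    expect d (p n) (@occurrence_count R n _ P.1 P.2) <= val n * term k P n.
  apply: filter_forall => k; apply: filter_forall => P.
  have [imp|nimp] := boolP (@improvement d V S W k P); last first.
    by apply: filterE => n imp; case/negP: nimp.
  have /asboolP[Pu Sle Wle kle klt] := imp.
  near=> n; move=> _.
  have v0 : 0 < val n by near: n; exact: mean_value_gt0.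
  rewrite /term mulrA -(mean_ratio_le k v0 Sle Wle).
  rewrite (mulrC (val n)) divfK ?lt0r_neq0 // -[in X in mean_value X](card_ord k) -card_sum.
  by near: n; exact: expect_count_le_mean.
near=> n; have v0 : 0 < val n by near: n; exact: mean_value_gt0.
apply/andP; split.
  apply: divr_ge0; last exact: ltW.
  by apply: expect_ge0 => // H _; apply: sumr_ge0 => f _; rewrite ler0n.
rewrite ler_pdivrMr //.
apply: (@le_trans _ _ (expect d (p n) (fun H => \sum_(k < (d * s.*2.+1).+1)
    \sum_(P | @improvement d V S W k P) @occurrence_count R n _ P.1 P.2 H))).
  by apply: expect_le => // H /uniformP Hu; apply: count_bad_le.
rewrite expect_sum mulr_suml; apply: ler_sum => k _.
rewrite expect_sum mulr_suml; apply: ler_sum => P imp.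
by rewrite mulrC; move: k P imp; near: n.
Unshelve. all: by end_near. Qed.

Lemma expect_lim_le : exists2 a : nat -> R, a @ \oo --> (1 : R) &
  \forall n \near \oo, a n <= expect d (p n) (@X n) / val n.
Proof.
exists (fun n => (n ^_ #|V|)%:R / n%:R ^+ #|V| *
  ((1 - p n) ^+ touch_count d n #|W| / Q n ^+ #|W|)).
  exact: lim_mul (@lim_falling R #|V|) (touch_lim #|W|) (mulr1 1).
near=> n; have v0 : 0 < val n by near: n; exact: mean_value_gt0.
rewrite ler_pdivlMr //; apply: le_trans (@expect_count_ge R d n (p n) (p01 n) V S W Su).
rewrite le_eqVlt; apply/orP; left; apply/eqP; rewrite /val /mean_value.
have n0 : (n%:R : R) != 0.
  by rewrite pnatr_eq0 -lt0n; near: n; exact: nbhs_infty_gt.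
have alg (a b c x y : R) : x != 0 -> y != 0 ->
  a / x * (c / y) * (x * b * y) = a * (b * c) by move=> x0 y0; field; rewrite ?x0 ?y0.
by apply: alg; apply: expf_neq0 => //; exact: lt0r_neq0.
Unshelve. all: by end_near. Qed.

(** Disjoint pairs contribute the square of the mean. The mean of the union of two
    occurrences is this square divided by the mean of their intersection, which
    tends to infinity when the pattern is admissible. *)
Lemma expect_sqr_lim_le : exists2 b : nat -> R, b @ \oo --> (1 : R) &
  \forall n \near \oo, expect d (p n) (fun H => @X n H ^+ 2) / val n ^+ 2 <= b n.
Proof.
pose term j (g : {ffun V -> V + 'I_j}) n :=
  (mean_value #|overlap g| #|overlap_edges S g| #|overlap_marks W g| n)^-1 *
  correction #|merge_edges S g| #|merge_marks W g| n.
exists (fun n => correction #|double_edges S| #|double_marks W| n +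
  \sum_(j < #|V|.+1) \sum_(g : {ffun V -> V + 'I_j} | mergeable S W g) term j g n).
  apply: lim_add (correction_lim _ _) _ (addr0 _).
  apply: lim_sum0 => j _; apply: lim_sum0 => g /asboolP[gI _ ov0 cf].
  apply: lim_mul (correction_lim _ _) (mul0r _); apply: adm cf _ ov0.
  by apply/fintype.subsetP => w; rewrite inE => /andP[].
have le1 : \forall n \near \oo,
    expect d (p n) (@occurrence_count R n _ (double_edges S) (double_marks W)) <=
    val n ^+ 2 * correction #|double_edges S| #|double_marks W| n.
  have := expect_count_le_mean (double_marks W) (double_uniform Su).
  apply: filterS => n; rewrite card_sum.
  by rewrite {1}(card_double_edges Su) {1}(card_double_marks W) mean_valueD.
have le2 : \forall n \near \oo, forall (j : 'I_#|V|.+1) (g : {ffun V -> V + 'I_j}),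
    mergeable S W g ->
    expect d (p n) (@occurrence_count R n _ (merge_edges S g) (merge_marks W g)) <=
    val n ^+ 2 * term j g n.
  apply: filter_forall => j; apply: filter_forall => g.
  have [mg|nmg] := boolP (mergeable S W g); last first.
    by apply: filterE => n mg; case/negP: nmg.
  have /asboolP[gI cV _ _] := mg.
  near=> n; move=> _.
  have v0 : 0 < val n by near: n; exact: mean_value_gt0.
  have o0 : 0 < mean_value #|overlap g| #|overlap_edges S g| #|overlap_marks W g| n.
    by near: n; exact: mean_value_gt0.
  have -> : val n ^+ 2 * term j g n =
      mean_value #|{: V + 'I_j}| #|merge_edges S g| #|merge_marks W g| n *
      correction #|merge_edges S g| #|merge_marks W g| n.
    rewrite /term mulrA; congr (_ * _).
    apply: (mulIf (lt0r_neq0 o0)); rewrite -mulrA mulVf ?lt0r_neq0 // mulr1.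
    rewrite -mean_valueD card_merge_edges // card_merge_marks // card_sum card_ord.
    have -> : (#|V| + j + #|overlap g| = #|V| + #|V|)%N by rewrite -addnA [X in (_ + X)%N]addnC cV.
    by rewrite expr2 -mean_valueD.
  by near: n; apply: expect_count_le_mean; exact: merge_uniform.
near=> n; have v0 : 0 < val n by near: n; exact: mean_value_gt0.
rewrite ler_pdivrMr ?exprn_gt0 // mulrC mulrDr.
apply: le_trans (expect_le (p01 n) (fun H _ => @count_sqr_le R n V S W H)) _.
rewrite expectD; apply: lerD; first by near: n.
rewrite expect_sum mulr_sumr; apply: ler_sum => j _.
rewrite expect_sum mulr_sumr; apply: ler_sum => g mg.
by move: j g mg; near: n.
Unshelve. all: by end_near. Qed.

(** If every occurrence is defective, the normalized counts [x] of occurrences and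
    [y] of defective ones coincide, and [1 <= 4 (x - 1)^2 + 2 y] whether [x] is
    below or above [1 / 2]. The expectation of the right-hand side tends to [0]. *)
Lemma whp_occurs_generically :
  whp (fun n H => exists f : V -> 'I_n, occurs_generically H s S W f).
Proof.
have [a a1 aX] := expect_lim_le; have [b b1 bX] := expect_sqr_lim_le.
have lim0 : (fun n => 4 * (b n + (-2 * a n + 1)) + 2 * (expect d (p n) (@Y n) / val n))
    @ \oo --> (0 : R).
  apply: (@lim_add _ _ _ 0 0) (addr0 _); last first.
    by apply: lim_scale expect_bad_lim (mulr0 _).
  apply: (@lim_scale _ _ 0) (mulr0 _); apply: (@lim_add _ _ _ 1 (-1)) => //.
    apply: (@lim_add _ _ _ (-2) 1) => //.
    - by apply: lim_scale a1 (mulr1 _).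
    - exact: cvg_cst.
    - by ring.
  by ring.
apply: lim0_le lim0; near=> n; rewrite prob_ge0 //=.
have v0 : 0 < val n by near: n; exact: mean_value_gt0.
have v0' := lt0r_neq0 v0.
apply: (@le_trans _ _ (expect d (p n) (fun H => 4 * ((val n ^+ 2)^-1 * @X n H ^+ 2 +
    ((- 2 / val n) * @X n H + 1)) + (2 / val n) * @Y n H))).
  rewrite probE; apply: expect_le => // H /uniformP Hu.
  have X0 : 0 <= @X n H by apply: sumr_ge0 => f _; rewrite ler0n.
  have Y0 : 0 <= @Y n H by apply: sumr_ge0 => f _; rewrite ler0n.
  set x := @X n H / val n; set y := @Y n H / val n.
  have y0 : 0 <= y by rewrite divr_ge0 // ltW.
  have -> : 4 * ((val n ^+ 2)^-1 * @X n H ^+ 2 +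
    ((- 2 / val n) * @X n H + 1)) + (2 / val n) * @Y n H = 4 * (x - 1) ^+ 2 + 2 * y.
    by rewrite /x /y; field.
  have sq := sqr_ge0 (x - 1).
  case: asboolP => [nex|_] /=; last by lra.
  have xy : x = y.
    rewrite /x /y /X /Y /occurrence_count /count_bad; congr (_ / _).
    apply: eq_bigr => f _; congr (nat_of_bool _)%:R.
    apply/asboolP/asboolP => [oc|[]//]; split=> // og.
    by apply: nex; exists f.
  rewrite -xy in y0 *; nra.
rewrite expectD !expectZ expectD !expectZ expectD expectZ expect1.
apply: lerD; last by rewrite mulrAC mulrA.
rewrite ler_pM2l // lerD //.
  by rewrite mulrC; near: n.
rewrite lerD2r mulrAC -mulrA ler_nM2l ?oppr_lt0 //.
by near: n.
Unshelve. all: by end_near. Qed.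

End SecondMoment.

Lemma whp_saturated K : whp (fun n H => saturated d abundant H K).
Proof.
have : whp (fun n H => forall (v : 'I_K.+1)
   (SW : {set {set 'I_v}} * {set 'I_v}), uniform d SW.1 ->
   admissible abundant (copy_edges K SW.1) (copy_marks K SW.2) ->
   exists f : 'I_K * 'I_v -> 'I_n,
     occurs_generically H K (copy_edges K SW.1) (copy_marks K SW.2) f).
  apply: whp_forall => v; apply: whp_forall => SW.
  apply: whp_impl => Su; apply: whp_impl => adm.
  apply: whp_occurs_generically => // e /copy_edgesP[i [e' e'S ->]].
  by rewrite card_imset ?Su //; exact: pair_inj.
apply: whp_le => n H _ h v S W vK Su adm.
have vK' : (v < K.+1)%N by rewrite ltnS.
exact: (h (Ordinal vK') (S, W)).
Qed.

Lemma whp_good_model K : whp (fun n H => good_model d vanishing abundant H K).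
Proof.
apply: whp_le (whp_and (whp_sparse K) (whp_saturated K)) => n H /uniformP Hu [sp sat].
by split.
Qed.

Hypothesis d_gt0 : (0 < d)%N.
Hypothesis vanishing_or_abundant : forall v e m, (0 < v)%N -> (v <= d * e + 1)%N ->
  vanishing v e m \/ abundant v e m.
Variable M : nat.
Hypothesis excess_vanishing : forall v e m : nat, (0 < v)%N -> (v <= d * e + 1)%N ->
  (M < d * e + 1 - v + m)%N -> vanishing v e m.

Lemma occurs_generically_empty (T : finType) (H : {set {set T}}) s (f : 'I_0 -> T) :
  occurs_generically H s finset.set0 finset.set0 f.
Proof.
split; first by case.
have -> : f @: [set: 'I_0] = finset.set0.
  by apply/setP => x; rewrite inE; apply/imsetP => -[[]].
rewrite /edge_image !imset0; split.
- split; rewrite ?finset.sub0set // => ?; rewrite ?inE // => e.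
- by move=> u; rewrite inE.
- by case: s => //= s e z _ _ _; rewrite inE.
Qed.

(** Typical hypergraphs of all sizes agree on the sentence: played from the empty
    pattern, the game never separates two of them. *)
Theorem zero_one_of_dichotomy : zero_one_law d p.
Proof.
move=> phi; set prob := fun n => _.
have [s [K hK]] := sat_invariant d_gt0 vanishing_or_abundant abundantD
  excess_vanishing phi 0.
have agree n n' (H : {set {set 'I_n}}) (H' : {set {set 'I_n'}}) :
    good_model d vanishing abundant H K -> good_model d vanishing abundant H' K ->
    models H phi = models H' phi.
  move=> gH gH'; rewrite /models.
  pose f (k : nat) (i : 'I_0) : 'I_k := match notF (ltn_ord i) with end.
  have := hK K (leqnn K) _ _ H H' gH gH' 'I_0 finset.set0 finset.set0 (f n) (f n')
    _ (occurs_generically_empty _ _ _) (occurs_generically_empty _ _ _) id.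
  by apply; rewrite card_ord.
have good0 := whp_good_model K.
have [[n0 [H0 [g0 m0]]]|none] := pselect (exists n (H : {set {set 'I_n}}),
    good_model d vanishing abundant H K /\ models H phi).
  right.
  have np0 : (fun n => 1 - prob n) @ \oo --> (0 : R).
    apply: lim0_le good0; near=> n; rewrite /prob -probC // prob_ge0 //=.
    apply: prob_le => // H _ nm; apply/asboolP => gH.
    by move: nm; rewrite (agree _ _ _ _ gH g0) m0.
  have np1 : (fun n => - (1 - prob n)) @ \oo --> (- 0 : R) by exact: cvgN.
  apply: (lim_eq _ (lim_add (@cvg_cst _ (1 : R) _ _ _) np1 (subr0 _))).
  by near=> n; rewrite /= opprB addrC subrK.
left; apply: lim0_le good0; near=> n; rewrite prob_ge0 //=.
apply: prob_le => // H _ mH; apply/asboolP => gH.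
by apply: none; exists n, H.
Unshelve. all: by end_near. Qed.

End HighProbability.

(** * Comparison of growth rates *)

Section Scales.
Local Open Scope classical_set_scope.
Local Open Scope ring_scope.
Variable R : realType.
Implicit Types (f g : nat -> R) (s k : R).

Lemma lim_ln_infty f : f @ \oo --> +oo -> (fun n => ln (f n)) @ \oo --> +oo.
Proof.
move=> /cvgryPge foo; apply/cvgryPge => A; near=> n.
have fA : expR A <= f n by near: n; exact: foo.
have f0 : 0 < f n := lt_le_trans (expR_gt0 A) fA.
by rewrite -(expRK A) ler_ln // posrE ?expR_gt0.
Unshelve. all: by end_near. Qed.

Lemma lim_ninfty_le f g s : g @ \oo --> +oo -> s < 0 ->
  (\forall n \near \oo, f n <= s * g n) -> f @ \oo --> -oo.
Proof.
move=> /cvgryPge goo s0 fg; apply/cvgrNyPle => A; near=> n.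
have : f n <= s * g n by near: n.
move/le_trans; apply.
have : A / s <= g n by near: n; exact: goo.
by rewrite ler_ndivrMr // mulrC.
Unshelve. all: by end_near. Qed.

Lemma lim_expR_ninfty f : f @ \oo --> -oo -> (fun n => expR (f n)) @ \oo --> (0 : R).
Proof.
move=> fo; have fo' : (fun n => - f n) @ \oo --> +oo by apply/cvgNry.
have := cvg_comp _ _ fo' (@cvgr_expR R).
by apply: lim_eq; near=> n; rewrite /= opprK.
Unshelve. all: by end_near. Qed.

Lemma ratio_ninfty f g s : g @ \oo --> +oo -> s < 0 ->
  (fun n => f n / g n) @ \oo --> s -> f @ \oo --> -oo.
Proof.
move=> goo s0 fg; have ss : s < s / 2 by lra.
apply: (@lim_ninfty_le f g (s / 2)) => //; first lra.
near=> n; have g0 : 0 < g n by near: n; apply: (cvgryPgt _).1 goo 0.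
rewrite -ler_pdivrMr //; apply: ltW; near: n; exact: (cvgr_lt s fg _ ss).
Unshelve. all: by end_near. Qed.

Lemma ln_le_subr1 (x : R) : 0 < x -> ln x <= x - 1.
Proof.
move=> x0; have := @le_ln1Dx R (x - 1); rewrite (addrC 1) subrK; apply.
by rewrite ltrBDr addrC subrr.
Qed.

(** For [f <= k g] apply [ln y <= y - 1] to [y = D f], with [D] small. *)
Lemma ln_negligible f g k : g @ \oo --> +oo -> 0 < k ->
    (\forall n \near \oo, 1 <= f n <= k * g n) ->
  (fun n => ln (f n) / g n) @ \oo --> (0 : R).
Proof.
move=> goo k0 fg; apply/cvgrPdist_lt => e e0.
pose D := e / 2 / k; have D0 : 0 < D by rewrite !divr_gt0.
near=> n; have /andP[f1 fk] : 1 <= f n <= k * g n by near: n.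
have f0 : 0 < f n by lra.
have g0 : 0 < g n by near: n; apply: (cvgryPgt _).1 goo 0.
have gC : - ln D / (e / 4) <= g n by near: n; apply: (cvgryPge _).1 goo _.
rewrite sub0r normrN ger0_norm; last by rewrite divr_ge0 ?ln_ge0 // ltW.
rewrite ltr_pdivrMr //.
have := ln_le_subr1 (mulr_gt0 D0 f0).
rewrite lnM ?posrE //.
have : D * f n <= e / 2 * g n.
  have -> : e / 2 * g n = D * (k * g n) by rewrite /D; field; rewrite lt0r_neq0.
  by rewrite ler_pM2l.
have : - ln D <= e / 4 * g n.
  by move: gC; rewrite ler_pdivrMr ?divr_gt0 // mulrC.
have := mulr_gt0 e0 g0; nra.
Unshelve. all: by end_near. Qed.

Lemma bernoulli_le (x : R) (k : nat) : 0 <= x <= 1 -> 1 - k%:R * x <= (1 - x) ^+ k.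
Proof.
move=> /andP[x0 x1]; elim: k => [|k IH]; first by rewrite mul0r subr0 expr0.
rewrite exprS; have y0 : 0 <= 1 - x by lra.
apply: le_trans (ler_wpM2l y0 IH).
have k0 : 0 <= k%:R :> R by rewrite ler0n.
have kx : 0 <= k%:R * (x * x) by rewrite mulr_ge0 // mulr_ge0.
by rewrite -natr1; nra.
Qed.

End Scales.

(** * The number of potential edges at given vertices *)

Section TouchCount.
Local Open Scope nat_scope.

(** The last term counts the edges that meet [m.+1] given vertices only in the
    last of them; the identity is Pascal's rule. *)
Lemma touch_countS d n m : m < n ->
  touch_count d n m.+1 = touch_count d n m + 'C(n - m.+1, d).
Proof.
move=> mn; rewrite /touch_count; have -> : n - m = (n - m.+1).+1 by lia.
have := @leq_bin2l (n - m.+1).+1 n d.+1; rewrite binS; lia.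
Qed.

Lemma expn_mono a b d : a <= b -> a ^ d <= b ^ d.
Proof. by case: d => // d; rewrite leq_exp2r. Qed.

Lemma ffact_le_expn n d : n ^_ d <= n ^ d.
Proof.
elim: d => [|d IH]; first by rewrite ffactn0 expn0.
by rewrite ffactnSr expnSr leq_mul // leq_subr.
Qed.

Lemma expn_le_ffact n d : (n - d) ^ d <= n ^_ d.
Proof.
suff h k : k <= d -> (n - d) ^ k <= n ^_ k by exact: h.
elim: k => [|k IH] kd; first by rewrite ffactn0 expn0.
rewrite ffactnSr expnSr; apply: leq_mul; first exact/IH/ltnW.
exact/leq_sub2l/ltnW.
Qed.

Lemma touch_count_le d n m : m <= n -> touch_count d n m * d`! <= m * n ^ d.
Proof.
elim: m => [|m IH] mn; first by rewrite /touch_count subn0 subnn.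
rewrite touch_countS // mulnDl mulSn addnC; apply: leq_add; last exact/IH/ltnW.
rewrite bin_ffact; apply: leq_trans (ffact_le_expn _ _) _.
by apply: expn_mono; exact: leq_subr.
Qed.

Lemma touch_count_ge d n m : m <= n -> m * (n - m - d) ^ d <= touch_count d n m * d`!.
Proof.
elim: m => [|m IH] mn; first by rewrite mul0n.
rewrite touch_countS // mulnDl mulSn addnC; apply: leq_add.
  apply: leq_trans (IH (ltnW mn)); rewrite leq_mul2l; apply/orP; right.
  by apply: expn_mono; lia.
by rewrite bin_ffact expn_le_ffact.
Qed.

End TouchCount.

(** * Sparse random hypergraphs of logarithmic mean degree *)

Section Regime.
Local Open Scope classical_set_scope.
Local Open Scope ring_scope.
Variables (R : realType) (d : nat) (p : nat -> R) (c : R).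
Hypothesis d_gt0 : (0 < d)%N.
Hypothesis p01 : forall n, 0 <= p n <= 1.
Hypothesis c_gt0 : 0 < c.

Let L n : R := ln n%:R.
Definition mean_degree n : R := n%:R ^+ d * (p n / d`!%:R).
Local Notation mu := mean_degree.
Definition scaled_degree n : R := n%:R ^+ d * p n.
Local Notation lam := scaled_degree.
Definition isolation n : R := expR (- mu n).

Hypothesis mu_lim : (fun n => mu n / L n) @ \oo --> c.

Definition log_mean (v e m n : nat) : R := v%:R * L n + e%:R * ln (p n) - m%:R * mu n.

Lemma L_infty : L @ \oo --> +oo.
Proof. exact/lim_ln_infty/cvgr_idn. Qed.

Lemma L_gt (A : R) : \forall n \near \oo, A < L n.
Proof. exact: (cvgryPgt _).1 L_infty A. Qed.

Lemma n_gt0 : \forall n \near \oo, 0 < (n%:R : R).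
Proof. by near=> n; rewrite ltr0n; near: n; exact: nbhs_infty_gt. Unshelve. all: by end_near. Qed.

Lemma mu_infty : mu @ \oo --> +oo.
Proof.
apply/cvgNrNy; apply: (@ratio_ninfty _ _ L (- c)); first exact: L_infty.
  by rewrite oppr_lt0.
have h : (fun n => - (mu n / L n)) @ \oo --> - c by exact: cvgN.
by apply: lim_eq h; near=> n; rewrite mulNr.
Unshelve. all: by end_near. Qed.

Lemma lamE n : lam n = d`!%:R * mu n.
Proof.
rewrite /mu /lam mulrCA; congr (_ * _); by rewrite mulrC divfK.
Qed.

Lemma fact_ge1 : 1 <= d`!%:R :> R.
Proof. by rewrite ler1n fact_gt0. Qed.

Lemma lam_ge1 : \forall n \near \oo, 1 <= lam n.
Proof.
near=> n; rewrite lamE; have : 1 <= mu n.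
  by near: n; apply: (cvgryPge _).1 mu_infty 1.
have := fact_ge1; nra.
Unshelve. all: by end_near. Qed.

Lemma regime_p_gt0 : \forall n \near \oo, 0 < p n.
Proof.
near=> n; have l1 : 1 <= lam n by near: n; exact: lam_ge1.
have /andP[p0 _] := p01 n; rewrite lt_neqAle p0 andbT; apply/eqP => pE.
by move: l1; rewrite /lam -pE mulr0 ler10.
Unshelve. all: by end_near. Qed.

Lemma ln_lam_negligible : (fun n => ln (lam n) / L n) @ \oo --> (0 : R).
Proof.
apply: (@ln_negligible _ _ _ (d`!%:R * (2 * c))) L_infty _ _.
  by rewrite mulr_gt0 ?mulr_gt0 // ltr0n fact_gt0.
have c2 : c < 2 * c by move: c_gt0; lra.
near=> n; apply/andP; split; first by near: n; exact: lam_ge1.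
rewrite lamE -mulrA ler_wpM2l ?ler0n //.
have L0 : 0 < L n by near: n; exact: L_gt.
rewrite -ler_pdivrMr //; apply: ltW; near: n; exact: (cvgr_lt c mu_lim _ c2).
Unshelve. all: by end_near. Qed.

Lemma log_meanE v e m : \forall n \near \oo, log_mean v e m n =
  (v%:R - (d * e)%:R) * L n + e%:R * ln (lam n) - m%:R * mu n.
Proof.
near=> n; have n0 : 0 < (n%:R : R) by near: n; exact: n_gt0.
have p0 : 0 < p n by near: n; exact: regime_p_gt0.
rewrite /lam lnM ?posrE ?exprn_gt0 // lnXn // -mulr_natl natrM /log_mean /L.
by ring.
Unshelve. all: by end_near. Qed.

Lemma mean_value_log v e m : \forall n \near \oo,
  expR (log_mean v e m n) = mean_value p isolation v e m n.
Proof.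
near=> n; have n0 : 0 < (n%:R : R) by near: n; exact: n_gt0.
have p0 : 0 < p n by near: n; exact: regime_p_gt0.
rewrite /log_mean /mean_value !expRD -mulrN !expRM_natl /L /isolation.
by rewrite !lnK ?posrE.
Unshelve. all: by end_near. Qed.

(** Only the powers of [n] matter on the scale of [ln n]: the logarithm of
    [n^d p] is negligible. *)
Lemma log_mean_slope v e m :
  (fun n => log_mean v e m n / L n) @ \oo --> v%:R - (d * e)%:R - m%:R * c.
Proof.
have h : (fun n => (v%:R - (d * e)%:R) + (e%:R * (ln (lam n) / L n) +
    - m%:R * (mu n / L n))) @ \oo --> v%:R - (d * e)%:R - m%:R * c.
  apply: lim_add (cvg_cst _) _ (erefl _).
  apply: lim_add (lim_scale ln_lam_negligible (mulr0 _))
    (lim_scale mu_lim (erefl _)) _.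
  by rewrite add0r mulNr.
apply: lim_eq h; near=> n.
have -> : log_mean v e m n =
    (v%:R - (d * e)%:R) * L n + e%:R * ln (lam n) - m%:R * mu n.
  by near: n; exact: log_meanE.
have L0 : L n != 0 by apply: lt0r_neq0; near: n; exact: L_gt.
by field.
Unshelve. all: by end_near. Qed.

Lemma vanishing_log v e m : log_mean v e m @ \oo --> -oo -> vanishing p isolation v e m.
Proof. by move=> /lim_expR_ninfty; apply: lim_eq; exact: mean_value_log. Qed.

Lemma abundant_log v e m : log_mean v e m @ \oo --> +oo -> abundant p isolation v e m.
Proof.
move=> /cvgNrNy/lim_expR_ninfty; apply: lim_eq.
have := mean_value_log v e m; apply: filterS => n <-.
by rewrite expRN.
Qed.

Lemma vanishing_slope v e m : v%:R - (d * e)%:R - m%:R * c < 0 ->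
  vanishing p isolation v e m.
Proof.
by move=> s0; apply: vanishing_log; exact: (@ratio_ninfty R (log_mean v e m) L _ L_infty s0 (@log_mean_slope v e m)).
Qed.

Lemma abundant_slope v e m : 0 < v%:R - (d * e)%:R - m%:R * c ->
  abundant p isolation v e m.
Proof.
move=> s0; apply: abundant_log; apply/cvgNrNy.
apply: (@ratio_ninfty _ _ L (- (v%:R - (d * e)%:R - m%:R * c))) => //.
- exact: L_infty.
- by rewrite oppr_lt0.
have h : (fun n => - (log_mean v e m n / L n)) @ \oo -->
    - (v%:R - (d * e)%:R - m%:R * c).
  apply: cvgN; exact: log_mean_slope.
by apply: lim_eq h; near=> n; rewrite mulNr.
Unshelve. all: by end_near. Qed.

Lemma regime_drift v e m : (v < d * e)%N \/ (v <= d * e)%N /\ (0 < m)%N ->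
  vanishing p isolation v e m.
Proof.
move=> h; apply: vanishing_slope; case: h => [lt|[le m0]].
  have : v%:R + 1 <= (d * e)%:R :> R by rewrite natr1 ler_nat.
  have : 0 <= m%:R * c by rewrite mulr_ge0 ?ler0n // ltW.
  by lra.
have : v%:R <= (d * e)%:R :> R by rewrite ler_nat.
have : 0 < m%:R * c by rewrite mulr_gt0 // ltr0n.
by lra.
Qed.

(** Each cycle lowers the exponent [v - d e - m c] by [1] and each complete vertex
    lowers it by [c], so it is negative once [M c > 1]. *)
Lemma regime_excess : exists M, forall v e m : nat, (0 < v)%N ->
  (v <= d * e + 1)%N -> (M < d * e + 1 - v + m)%N -> vanishing p isolation v e m.
Proof.
pose M := (Num.truncn (c^-1)).+1; exists M => v e m v0 vle Mlt.
have Mc : 1 < M%:R * c.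
  by rewrite -ltr_pdivrMr // div1r; exact: truncnS_gt.
apply: vanishing_slope.
have [vde|vde] := ltnP v (d * e).
  have : v%:R + 1 <= (d * e)%:R :> R by rewrite natr1 ler_nat.
  have : 0 <= m%:R * c by rewrite mulr_ge0 ?ler0n // ltW.
  by lra.
have Mm : (M <= m)%N by move: vde vle Mlt; clear; lia.
have : M%:R * c <= m%:R * c by rewrite ler_wpM2r ?ler_nat // ltW.
have : v%:R <= (d * e)%:R + 1 :> R by rewrite natr1 ler_nat -addn1.
by lra.
Qed.

Hypothesis critical : forall e m, m%:R * c = 1 ->
  (fun n => L n + e%:R * ln (lam n) - m%:R * mu n) @ \oo --> -oo \/
  (fun n => L n + e%:R * ln (lam n) - m%:R * mu n) @ \oo --> +oo.

(** The exponent [v - d e - m c] decides, except for cycles, with [v = d e] and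
    [m = 0], whose mean [(n^d p)^e] tends to infinity, and for trees with [m c = 1]. *)
Lemma regime_dichotomy v e m : (0 < v)%N -> (v <= d * e + 1)%N ->
  vanishing p isolation v e m \/ abundant p isolation v e m.
Proof.
move=> v0 vle; have [s0|s0|s0] := ltgtP (v%:R - (d * e)%:R - m%:R * c) 0.
- by left; exact: vanishing_slope.
- by right; exact: abundant_slope.
have [vde|vde] := ltnP v (d * e).
  by left; apply: regime_drift; left.
have [vE|vE] : v = (d * e)%N \/ v = (d * e + 1)%N by move: vde vle; clear; lia.
  have m0 : m = 0%N.
    move/eqP: s0; rewrite vE subrr sub0r oppr_eq0 mulf_eq0 (gt_eqF c_gt0) orbF.
    by rewrite pnatr_eq0 => /eqP.
  have e0 : (0 < e)%N by move: v0; rewrite vE muln_gt0 => /andP[].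
  right; apply: abundant_log; apply/cvgNrNy.
  apply: (@lim_ninfty_le _ _ (fun n => ln (lam n)) (-1)); last 1 first.
  - near=> n; change (- log_mean v e m n <= -1 * ln (lam n)).
    have -> : log_mean v e m n =
        (v%:R - (d * e)%:R) * L n + e%:R * ln (lam n) - m%:R * mu n.
      by near: n; exact: log_meanE.
    rewrite vE m0 subrr mul0r mul0r subr0 add0r mulN1r lerN2.
    have l0 : 0 <= ln (lam n) by rewrite ln_ge0 //; near: n; exact: lam_ge1.
    by rewrite ler_peMl // ler1n.
  - apply: lim_ln_infty; have := mu_infty => /cvgryPge muoo.
    apply/cvgryPge => A; near=> n; rewrite lamE.
    have m1 : 1 <= mu n by near: n; exact: muoo.
    have mA : A <= mu n by near: n; exact: muoo.
    by have := fact_ge1; nra.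
  - by lra.
have mc : m%:R * c = 1.
  by move: s0; rewrite vE natrD; lra.
have eqn : \forall n \near \oo, L n + e%:R * ln (lam n) - m%:R * mu n = log_mean v e m n.
  have := log_meanE v e m; apply: filterS => n ->.
  by rewrite vE natrD; ring.
have [ny|py] := critical e mc.
  left; apply: vanishing_log; move/cvgrNyPle: ny => ny; apply/cvgrNyPle => A.
  near=> n; have <- : L n + e%:R * ln (lam n) - m%:R * mu n = log_mean v e m n.
    by near: n.
  by near: n; exact: ny.
right; apply: abundant_log; move/cvgryPge: py => py; apply/cvgryPge => A.
near=> n; have <- : L n + e%:R * ln (lam n) - m%:R * mu n = log_mean v e m n.
  by near: n.
by near: n; exact: py.
Unshelve. all: by end_near. Qed.

Lemma lam_power_small (k : nat) : (fun n => lam n ^+ k / n%:R) @ \oo --> (0 : R).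
Proof.
have h : (fun n => expR (k%:R * ln (lam n) - L n)) @ \oo --> (0 : R).
  apply: lim_expR_ninfty; apply: (@ratio_ninfty _ _ L (-1)) => //.
  - exact: L_infty.
  have h : (fun n => k%:R * (ln (lam n) / L n) + (-1)) @ \oo --> (-1 : R).
    by apply: lim_add (lim_scale ln_lam_negligible (mulr0 _)) (cvg_cst _) _; rewrite add0r.
  apply: lim_eq h; near=> n.
  have L0 : L n != 0 by apply: lt0r_neq0; near: n; exact: L_gt.
  by field.
apply: lim_eq h; near=> n.
have n0 : 0 < (n%:R : R) by near: n; exact: n_gt0.
have l0 : 0 < lam n by apply: lt_le_trans ltr01 _; near: n; exact: lam_ge1.
by rewrite expRD expRM_natl expRN /L !lnK ?posrE.
Unshelve. all: by end_near. Qed.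

Lemma p_le_lam : \forall n \near \oo, p n <= lam n / n%:R.
Proof.
near=> n; have n1 : 1 <= (n%:R : R) by rewrite ler1n; near: n; exact: nbhs_infty_gt.
have /andP[p0 _] := p01 n.
rewrite ler_pdivlMr ?(lt_le_trans ltr01) // mulrC /lam ler_wpM2r //.
by rewrite -{1}(expr1 n%:R) ler_weXn2l.
Unshelve. all: by end_near. Qed.

Lemma regime_p_lim : p @ \oo --> (0 : R).
Proof.
have := lam_power_small 1; under eq_fun do rewrite expr1.
apply: lim0_le; near=> n; have /andP[-> _] /= := p01 n.
by near: n; exact: p_le_lam.
Unshelve. all: by end_near. Qed.

(** The exponent of [1 - p] is [m n^d / d!] up to a relative error of order
    [1 / n], and [ln (1 - p)] is [- p] up to an error of order [p^2]; both errors
    are small because a power of [n^d p] is negligible compared with [n]. *)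
Lemma touch_error m : exists2 E : nat -> R, E @ \oo --> (0 : R) &
  \forall n \near \oo, (1 - p n) ^+ touch_count d n m / isolation n ^+ m = expR (E n).
Proof.
exists (fun n => (touch_count d n m)%:R * ln (1 - p n) + m%:R * mu n); last first.
  near=> n; have p1 : p n < 1 by near: n; exact: (cvgr_lt 0 regime_p_lim _ ltr01).
  rewrite expRD expRM_natl lnK ?posrE ?subr_gt0 // /isolation -expRM_natl mulrN expRN.
  by rewrite invrK.
(* the factor [d * (m + d)] comes from Bernoulli's inequality for
   [((n - m - d) / n) ^+ d] *)
pose up n : R := m%:R * (d * (m + d))%:R / d`!%:R * (lam n ^+ 1 / n%:R).
pose lo n : R := - (2 * m%:R / d`!%:R) * (lam n ^+ 2 / n%:R).
have up0 : up @ \oo --> (0 : R) by apply: lim_scale (lam_power_small 1) (mulr0 _).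
have lo0 : lo @ \oo --> (0 : R) by apply: lim_scale (lam_power_small 2) (mulr0 _).
apply: squeeze_cvgr lo0 up0.
have h2 : 0 < 2^-1 :> R by lra.
near=> n.
have nmd : (m + d < n)%N by near: n; exact: nbhs_infty_gt.
have n0 : 0 < (n%:R : R) by near: n; exact: n_gt0.
have /andP[p0 _] := p01 n.
have p2 : p n < 2^-1 by near: n; exact: (cvgr_lt 0 regime_p_lim _ h2).
have l1 : 1 <= lam n by near: n; exact: lam_ge1.
have pl : p n <= lam n / n%:R by near: n; exact: p_le_lam.
have D0 : 0 < d`!%:R :> R by rewrite ltr0n fact_gt0.
have muE : mu n = lam n / d`!%:R by rewrite lamE mulrC mulKf // lt0r_neq0.
have mn : (m <= n)%N by move: nmd; clear; lia.
set N := touch_count d n m.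
have N0 : 0 <= N%:R :> R by rewrite ler0n.
have Nup : N%:R * p n <= m%:R * mu n.
  rewrite /mu mulrA mulrA ler_pdivlMr // mulrAC ler_wpM2r //.
  by rewrite -natrX -!natrM ler_nat touch_count_le.
have Nlo : m%:R * mu n * (1 - (d * (m + d))%:R / n%:R) <= N%:R * p n.
  pose x : R := (m + d)%:R / n%:R.
  have x01 : 0 <= x <= 1.
    by rewrite divr_ge0 ?ler0n //= ler_pdivrMr // mul1r ler_nat ltnW.
  have bern := bernoulli_le d x01.
  have xE : 1 - x = (n - m - d)%:R / n%:R.
    rewrite -subnDA natrB ?(ltnW nmd) // /x mulrBl divff ?lt0r_neq0 //.
  have -> : (d * (m + d))%:R / n%:R = d%:R * x by rewrite /x natrM mulrA.
  have mu0 : 0 <= m%:R * mu n by rewrite mulr_ge0 ?ler0n // muE divr_ge0 ?ltW //; lra.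
  apply: le_trans (ler_wpM2l mu0 bern) _.
  have -> : m%:R * mu n * (1 - x) ^+ d = (m * (n - m - d) ^ d)%:R * p n / d`!%:R.
    rewrite xE expr_div_n /mu natrM natrX; have nd : n%:R ^+ d != 0 :> R.
      by rewrite expf_neq0 // lt0r_neq0.
    have alg (a b x' y z : R) : x' != 0 -> y != 0 ->
        a * (x' * (b / y)) * (z / x') = a * z * b / y.
      by move=> h3 h4; field; rewrite ?h3 ?h4.
    by apply: alg => //; exact: lt0r_neq0.
  rewrite ler_pdivrMr // mulrAC ler_wpM2r //.
  by rewrite -natrM ler_nat touch_count_ge.
have ln_up : ln (1 - p n) <= - p n.
  by have := @ln_le_subr1 R (1 - p n); rewrite addrAC subrr add0r; apply; lra.
have ln_lo : - (p n * (1 + 2 * p n)) <= ln (1 - p n).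
  have q0 : 0 < 1 - p n by lra.
  have := @ln_le_subr1 R (1 - p n)^-1; rewrite lnV ?posrE // invr_gt0.
  move=> /(_ q0) h.
  have : (1 - p n)^-1 <= 1 + p n * (1 + 2 * p n).
    rewrite -div1r ler_pdivrMr //.
    have : 0 <= p n * p n * (1 - 2 * p n) by rewrite !mulr_ge0 //; lra.
    by nra.
  by lra.
apply/andP; split.
  have s1 : N%:R * - (p n * (1 + 2 * p n)) <= N%:R * ln (1 - p n) by rewrite ler_wpM2l.
  have s2 : 2 * p n * (N%:R * p n) <= 2 * p n * (m%:R * mu n).
    by rewrite ler_wpM2l // mulr_ge0.
  have s3 : 2 * p n * (m%:R * mu n) <= - lo n.
    rewrite /lo muE mulNr opprK.
    have -> : 2 * m%:R / d`!%:R * (lam n ^+ 2 / n%:R) =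
        2 * (lam n / n%:R) * (m%:R * (lam n / d`!%:R)) by rewrite expr2; ring.
    rewrite ler_wpM2r //; last by rewrite ler_pM2l.
    by rewrite mulr_ge0 ?ler0n // divr_ge0 ?ltW //; lra.
  by nra.
have s1 : N%:R * ln (1 - p n) <= N%:R * - p n by rewrite ler_wpM2l.
have s2 : m%:R * mu n * ((d * (m + d))%:R / n%:R) = up n.
  by rewrite /up muE expr1; ring.
by nra.
Unshelve. all: by end_near. Qed.

Lemma regime_touch_lim m :
  (fun n => (1 - p n) ^+ touch_count d n m / isolation n ^+ m) @ \oo --> (1 : R).
Proof.
have [E E0 hE] := touch_error m.
have h : (fun n => expR (E n)) @ \oo --> (1 : R).
  rewrite -expR0; exact: (continuous_cvg _ (@continuous_expR R 0) E0).
by apply: lim_eq h; apply: filterS hE => n.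
Qed.

Lemma regime_zero_one : zero_one_law d p.
Proof.
have [M hM] := regime_excess.
apply: (zero_one_of_dichotomy p01 regime_p_gt0 regime_p_lim (fun n => expR_gt0 _)
  regime_touch_lim regime_drift d_gt0 regime_dichotomy hM).
Qed.

End Regime.

(** * The critical window *)

Section Window.
Local Open Scope classical_set_scope.
Local Open Scope ring_scope.
Variables (R : realType) (d : nat) (p : nat -> R).

Lemma mean_degree_lim (C : R) : 0 < C ->
    asymp_equiv p (fun n => C * (ln n%:R / n%:R ^+ d)) ->
  (fun n => mean_degree d p n / ln n%:R) @ \oo --> C / d`!%:R.
Proof.
move=> C0 pC.
apply: lim_eq (lim_scale (k := C / d`!%:R) pC (mulr1 _)); near=> n.
have n0 : (n%:R : R) ^+ d != 0.
  by rewrite expf_neq0 // lt0r_neq0 //; near: n; exact: n_gt0.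
have L0 : ln (n%:R : R) != 0 by apply: lt0r_neq0; near: n; exact: L_gt.
have D0 : d`!%:R != 0 :> R by rewrite pnatr_eq0 -lt0n fact_gt0.
have alg (c a f x l : R) : c != 0 -> f != 0 -> x != 0 -> l != 0 ->
    c / f * (a / (c * (l / x))) = x * (a / f) / l.
  by move=> h1 h2 h3 h4; field; rewrite ?h1 ?h2 ?h3 ?h4.
by apply: alg => //; exact: lt0r_neq0.
Unshelve. all: by end_near. Qed.

Variable v : nat.
Hypothesis v_gt0 : (0 < v)%N.
Hypothesis mu_lim : (fun n => mean_degree d p n / ln n%:R) @ \oo --> (v%:R^-1 : R).

Let LL n : R := ln (ln n%:R).
Let omega n : R := (v%:R * n%:R ^+ d * (p n / d`!%:R) - ln n%:R) / LL n.
Let D e n : R := ln n%:R + e%:R * ln (scaled_degree d p n) - v%:R * mean_degree d p n.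

Lemma LL_infty : LL @ \oo --> +oo.
Proof. by apply: lim_ln_infty; exact: L_infty. Qed.

Lemma ln_lam_LL : (fun n => ln (scaled_degree d p n) / LL n) @ \oo --> (1 : R).
Proof.
have D0 : 0 < d`!%:R :> R by rewrite ltr0n fact_gt0.
have k0 : 0 < d`!%:R / v%:R :> R by rewrite divr_gt0 // ltr0n.
have h1 : (fun n => scaled_degree d p n / ln n%:R) @ \oo --> (d`!%:R / v%:R : R).
  apply: lim_eq (lim_scale (k := d`!%:R) mu_lim (erefl _)); near=> n.
  by rewrite lamE mulrA.
have h2 : (fun n => ln (scaled_degree d p n / ln n%:R)) @ \oo --> (ln (d`!%:R / v%:R) : R).
  exact: (continuous_cvg _ (continuous_ln k0) h1).
have LL0 : \forall n \near \oo, 0 < LL n by exact: (cvgryPgt _).1 LL_infty 0.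
have h3 : (fun n => (LL n)^-1) @ \oo --> (0 : R).
  exact: (gtr0_cvgV0 LL0).2 LL_infty.
have h4 : (fun n => ln (scaled_degree d p n / ln n%:R) * (LL n)^-1 + 1) @ \oo --> (1 : R).
  by apply: lim_add (lim_mul h2 h3 (mulr0 _)) (cvg_cst _) (add0r _).
apply: lim_eq h4; near=> n.
have L0 : 0 < ln (n%:R : R) by near: n; exact: L_gt.
have l0 : 0 < scaled_degree d p n / ln n%:R.
  by near: n; exact: (cvgr_gt _ h1 _ k0).
have l1 : 0 < scaled_degree d p n by rewrite -(pmulr_lgt0 _ (x := (ln n%:R)^-1)) ?invr_gt0.
have LLn : LL n != 0 by apply: lt0r_neq0; near: n.
by rewrite ln_div ?posrE // mulrBl -/(LL n) divff // subrK.
Unshelve. all: by end_near. Qed.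

Lemma windowE e : \forall n \near \oo, D e n / LL n =
  e%:R * (ln (scaled_degree d p n) / LL n) - omega n.
Proof.
near=> n; have LLn : LL n != 0.
  by apply: lt0r_neq0; near: n; exact: (cvgryPgt _).1 LL_infty 0.
have D0 : d`!%:R != 0 :> R by rewrite pnatr_eq0 -lt0n fact_gt0.
have alg (l el vv x y m : R) : m != 0 ->
    (l + el * x - vv * y) / m = el * (x / m) - (vv * y - l) / m by move=> m0; field.
by rewrite /D /omega -mulrA; apply: alg.
Unshelve. all: by end_near. Qed.

(** Up to the factor [ln (ln n)], the logarithm of the mean is [e - omega]. *)
Lemma window_critical e :
    [\/ omega @ \oo --> +oo, omega @ \oo --> -oo
      | exists C : R, omega @ \oo --> C /\ exists l : nat, l%:R - 1 < C < l%:R] ->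
  D e @ \oo --> -oo \/ D e @ \oo --> +oo.
Proof.
have LL0 : \forall n \near \oo, 0 < LL n by exact: (cvgryPgt _).1 LL_infty 0.
have hl := lim_scale (k := e%:R) ln_lam_LL (mulr1 _).
have e1 : e%:R < e%:R + 1 :> R by rewrite ltrDl.
have e2 : e%:R - 1 < e%:R :> R by rewrite gtrBl.
move=> [oo|oo|[C [oC [l /andP[lC Cl]]]]].
- left; apply: (lim_ninfty_le LL_infty (ltrN10 R)); near=> n.
  have L0 : 0 < LL n by near: n.
  rewrite -ler_pdivrMr //.
  have -> : D e n / LL n = e%:R * (ln (scaled_degree d p n) / LL n) - omega n.
    by near: n; exact: windowE.
  have h1 : e%:R * (ln (scaled_degree d p n) / LL n) < e%:R + 1.
    by near: n; exact: (cvgr_lt _ hl _ e1).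
  have h2 : e%:R + 2 <= omega n by near: n; exact: (cvgryPge _).1 oo _.
  by lra.
- right; apply/cvgNrNy; apply: (lim_ninfty_le LL_infty (ltrN10 R)); near=> n.
  have L0 : 0 < LL n by near: n.
  change (- D e n <= -1 * LL n); rewrite mulN1r lerN2 -[X in X <= _]mul1r -ler_pdivlMr //.
  have -> : D e n / LL n = e%:R * (ln (scaled_degree d p n) / LL n) - omega n.
    by near: n; exact: windowE.
  have h1 : e%:R - 1 < e%:R * (ln (scaled_degree d p n) / LL n).
    by near: n; exact: (cvgr_gt _ hl _ e2).
  have h2 : omega n <= e%:R - 2 by near: n; exact: (cvgrNyPle _).1 oo _.
  by lra.
have slope : (fun n => D e n / LL n) @ \oo --> e%:R - C.
  have oN : (fun n => - omega n) @ \oo --> - C by exact: cvgN.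
  by apply: lim_eq (lim_add hl oN (erefl _)); have := windowE e; apply: filterS => n ->.
have [eC|eC|eC] := ltgtP (e%:R : R) C.
- left; apply: (ratio_ninfty LL_infty _ slope); by rewrite subr_lt0.
- right; apply/cvgNrNy.
  have slopeN : (fun n => - (D e n / LL n)) @ \oo --> - (e%:R - C) by exact: cvgN.
  apply: (@ratio_ninfty _ _ LL (- (e%:R - C)) LL_infty).
    by rewrite oppr_lt0 subr_gt0.
  by apply: lim_eq slopeN; near=> n; rewrite mulNr.
(* the limit of omega would be the natural number [e] *)
exfalso; have el : (e < l)%N by rewrite -(ltr_nat R) eC.
have le : (l < e.+1)%N by rewrite -(ltr_nat R) -natr1 -ltrBlDr eC.
by move: el le; clear; lia.
Unshelve. all: by end_near. Qed.

End Window.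

(** * The zero-one law *)

Local Open Scope classical_set_scope.
Local Open Scope ring_scope.

Theorem theorem5p16 (R : realType) (d : nat) (hd : (1 <= d)%N)
    (p : nat -> R) (hp : forall n : nat, 0 <= p n <= 1)
    (hyp : exists v : nat, (1 <= v)%N /\
      ((exists C : R,
          d`!%:R / (v.+1)%:R < C < d`!%:R / v%:R /\
          asymp_equiv p (fun n => C * (ln n%:R / n%:R ^+ d)))
       \/
       (asymp_equiv p (fun n => d`!%:R / v%:R * (ln n%:R / n%:R ^+ d)) /\
        let omega (n : nat) : R :=
          (v%:R * n%:R ^+ d * (p n / d`!%:R) - ln n%:R) / ln (ln n%:R) in
        [\/ omega @ \oo --> +oo,
            omega @ \oo --> -oo
          | exists C : R, omega @ \oo --> C /\
              exists l : nat, l%:R - 1 < C < l%:R]))) :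
  zero_one_law d p.
Proof.
have D0 : 0 < d`!%:R :> R by rewrite ltr0n fact_gt0.
have [v [v1 [[C [/andP[Clo Chi] pC]]|[pC /= om]]]] := hyp.
  have v0 : 0 < v%:R :> R by rewrite ltr0n.
  have C0 : 0 < C by apply: lt_trans Clo; rewrite divr_gt0 // ltr0n.
  have c0 : 0 < C / d`!%:R by rewrite divr_gt0.
  apply: (regime_zero_one hd hp c0 (mean_degree_lim C0 pC)) => e m mC.
  exfalso; have mCd : m%:R * C = d`!%:R.
    by move: mC; rewrite mulrA => /(canRL (divfK (lt0r_neq0 D0))); rewrite mul1r.
  move: Clo; rewrite ltr_pdivrMr ?ltr0n // -mCd mulrC ltr_pM2l // ltr_nat => mv.
  move: Chi; rewrite ltr_pdivlMr // -mCd mulrC ltr_pM2r // ltr_nat.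
  by rewrite ltnNge -ltnS mv.
have v0 : 0 < v%:R :> R by rewrite ltr0n.
have mu_lim : (fun n => mean_degree d p n / ln n%:R) @ \oo --> (v%:R^-1 : R).
  have := mean_degree_lim (divr_gt0 D0 v0) pC.
  by rewrite mulrAC divff ?lt0r_neq0 // mul1r.
apply: (regime_zero_one hd hp _ mu_lim); first by rewrite invr_gt0.
move=> e m mv; have -> : m = v; last exact: window_critical.
apply/eqP; rewrite -(eqr_nat R); apply/eqP.
by move: mv => /(canRL (divfK (lt0r_neq0 v0))); rewrite mul1r.
Qed.
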